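(* Consider the projected stochastic Adam SQP method under the assumptions stated in the context. Define $$\tau := \frac{\sigma_{\min}\rho_{\min}}{\sigma_{\min}\rho_{\min} + \kappa_{\nabla f}\rho_{\max}}$$ along with $$G_1 := \frac{\tau \beta_1 L_{P\nabla f}^2}{(1-\beta_2)^{3/2}\sqrt{M^2+\kappa_{\nabla f}^2}},\qquad G_2 := \frac{(1-\beta_1) (\tau L_{\nabla f}+L_J)}{2(1-\beta_2)},$$ $$G_3 := \frac{\tau L_{P\nabla f}^2 \rho_{\max}^2 \kappa_c^2\sqrt{1-\beta_1}\,\beta_1(1+\beta_1)}{4\sqrt{M^2+\kappa_{\nabla f}^2}\sqrt{1-\beta_2}(1-\beta_1)^2\sigma_{\min}^{2}},\qquad G_4 := \frac{(\tau L_{\nabla f}+L_J) \rho_{\max}^2 \kappa_c^2}{2\sigma_{\min}^2}.$$ Then, for every positive integer $K$, \begin{align*} &\frac{1}{K} \sum_{k=1}^K \left( \frac{h_{\min}(1-\beta_1)}{2 h_{\max} \sqrt{M^2+\kappa_{\nabla f}^2}} \mathbb{E}[\|P_k\nabla f(x_k)\|_2^2] + \rho_{\min} \mathbb{E}[\|c_k\|_1] \right) \\ \leq\ & \frac{\phi(x_1,\tau) - \tau f_{\inf}}{\alpha \tau K} + \frac{6h_{\max}\sqrt{M^2 + \kappa_{\nabla f}^2} \sqrt{1-\beta_1}} {h_{\min} \sqrt{1-\beta_2}} \frac{n}{(1-\frac{\beta_1}{\beta_2})^{3/2}} \left( \frac{1}{K} \log \left(1 + \frac{M^2 + \kappa_{\nabla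 f}^2}{h_{\min}^2 (1-\beta_2) \epsilon} \right) -\log(\beta_2) \right) \\ & + \left(\frac{\alpha^2}{\tau} G_1 + \frac{\alpha}{\tau} G_2\right) \frac{n}{1 - \frac{\beta_1}{\beta_2}} \left( \frac{1}{K} \log \left(1 + \frac{M^2 + \kappa_{\nabla f}^2}{h_{\min}^2 (1 - \beta_2) \epsilon} \right) - \log(\beta_2) \right) + \frac{\alpha^2}{\tau} G_3 + \frac{\alpha}{\tau} G_4. \end{align*}
   Context: Problem. Consider $\min_{x\in\mathbb{R}^n} f(x)$ subject to $c(x)=0$, where $f:\mathbb{R}^n\to\mathbb{R}$ (with $f(x)=\mathbb{E}_\xi[F(x,\xi)]$ for a random variable $\xi$) and $c:\mathbb{R}^n\to\mathbb{R}^m$. Write $J(x)\in\mathbb{R}^{m\times n}$ for the Jacobian of $c$ at $x$ (i.e. $J=\nabla c^T$) and $P(x) := I - J(x)^T(J(x)J(x)^T)^{-1}J(x)$. Write $c_k:=c(x_k)$, $J_k:=J(x_k)$, $P_k:=P(x_k)$. For $\tau>0$ let $\phi(x,\tau):=\tau f(x)+\|c(x)\|_1$. $a\circ b$ is the component-wise product, $e$ the all-ones vector, $\mathrm{diag}(v)$ the diagonal matrix with diagonal $v$. Algorithm (projected stochastic Adam SQP). Inputs: initial point $x_1\in\mathbb{R}^n$, prescribed sequences $\{\rho_k\}\subset(0,1]$ and $\{h_k\}\subset\mathbb{R}_{>0}$, $\beta_1\in[0,1)$, $\beta_2\in(\beta_1,1)$, $\alpha\in(0,1]$, $\epsilon>0$.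 Set $r_0=s_0=0\in\mathbb{R}^n$. For $k=1,2,\dots$: obtain a stochastic gradient estimate $g_k\in\mathbb{R}^n$ of $\nabla f(x_k)$; set $v_k = -\rho_k J_k^T(J_kJ_k^T)^{-1}c_k$, $u_k=-h_k^{-1}P_kg_k$, $r_k=\beta_1 r_{k-1}+u_k$, $s_k=\beta_2 s_{k-1}+u_k\circ u_k$, $\eta_k=\frac{(1-\beta_1)\sqrt{1-\beta_2^k}}{\sqrt{1-\beta_2}}$, $d_k=v_k+\eta_kP_k\,\mathrm{diag}(s_k+\epsilon e)^{-1/2}r_k$, $x_{k+1}=x_k+\alpha d_k$. Probability. The only randomness is in the gradient estimates, and $\mathbb{E}$ is expectation on the underlying probability space. $\mathcal{F}_1$ is the $\sigma$-algebra defined by the (given) initial conditions, and $\mathcal{F}_k$ is the $\sigma$-algebra generated by the initial conditions and the stochastic gradient estimators $g_1,\dots,g_{k-1}$; $\{\mathcal{F}_k\}$ is a filtration. Assumptions. There is an open convex set $\mathcal{X}\subseteq\mathbb{R}^n$ containing all iterates of any run of the algorithm, over which $f$ is continuously differentiable and bounded below by $f_{\inf}\in\mathbb{R}$, and over which $c$ is continuously differentiable with $\|c(x)\|_2\le\kappa_c$ for all $x\in\mathcal{X}$, for some $\kappa_c>0$. There are positive constants $\kappa_{\nabla f},\kappa_J,L_{\nabla f},\hat L_J,\sigma_{\min}$ such that for all $x,\bar x\in\mathcal{X}$: $\|\nabla f(x)\|_2\le\kappa_{\nabla f}$; $\|J(x)\|_2\le\kappa_J$; $\|\nabla f(x)-\nabla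 f(\bar x)\|_2\le L_{\nabla f}\|x-\bar x\|_2$; $\|J(x)-J(\bar x)\|_2\le\hat L_J\|x-\bar x\|_2$; and the smallest singular value of $J(x)$ is at least $\sigma_{\min}$ (with $m\le n$, so $J(x)$ has full row rank). For all $k\ge1$, $\mathbb{E}[P_kg_k|\mathcal{F}_k]=P_k\nabla f(x_k)$, and there is a constant $M\in\mathbb{R}$ with $\mathbb{E}[\|P_k(g_k-\nabla f(x_k))\|_2^2|\mathcal{F}_k]\le M^2$ for all $k\ge 1$. There are $\rho_{\min},\rho_{\max}\in(0,1]$ and $h_{\min},h_{\max}>0$ with $\rho_{\min}\le\rho_k\le\rho_{\max}$ and $h_{\min}\le h_k\le h_{\max}$ for all $k\ge 1$. In addition, for all $k\ge1$, $\|u_k\|_\infty=\|h_k^{-1}P_kg_k\|_\infty\le\sqrt{\frac{M^2+\kappa_{\nabla f}^2}{h_k^2}-\epsilon}$ (where the quantity under the root is nonnegative). Derived constants (which exist under these assumptions). $L_J>0$ is a constant with $\|c(\bar x)\|_1\le\|c(x)+J(x)(\bar x-x)\|_1+\frac12L_J\|\bar x-x\|_2^2$ for all $x,\bar x\in\mathcal{X}$, and $L_{P\nabla f}>0$ is a constant with $\|P(x)\nabla f(x)-P(\bar x)\nabla f(\bar x)\|_2\le L_{P\nabla f}\|x-\bar x\|_2$ for all $x,\bar x\in\mathcal{X}$. *)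

(* Defs.v *)
From mathcomp Require Import all_boot all_order all_algebra.
From mathcomp Require Import all_classical all_reals all_analysis.
Set Implicit Arguments.
Unset Strict Implicit.
Unset Printing Implicit Defensive.
Import Order.TTheory GRing.Theory Num.Theory.
Import numFieldNormedType.Exports.
Local Open Scope classical_set_scope.
Local Open Scope ring_scope.

(* Points of R^n are row vectors 'rV[R]_n, the type on which the library states
   its Jacobian.  [A *v x] is the usual product of the matrix A with the vector
   x seen as a column, i.e. (A *m x^T)^T. *)
Definition mxact {R : realType} {m n : nat} (A : 'M[R]_(m, n))
  (x : 'rV[R]_n) : 'rV[R]_m := x *m A^T.
Notation "A *v x" := (mxact A x) (at level 40, left associativity) : ring_scope.

(* The library norm `|x| of a vector is the max norm. *)
Definition norm1 {R : realType} {n : nat} (x : 'rV[R]_n) : R :=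
  \sum_(i < n) `|x 0 i|.
Definition norm2 {R : realType} {n : nat} (x : 'rV[R]_n) : R :=
  Num.sqrt (\sum_(i < n) x 0 i ^+ 2).

Definition spectral_norm {R : realType} {m n : nat} (A : 'M[R]_(m, n)) : R :=
  sup [set norm2 (A *v x) | x in [set x : 'rV[R]_n | norm2 x <= 1]].

(* For m <= n, an m x n matrix A has m singular values: the nonnegative square
   roots of the eigenvalues of A A^T. *)
Definition singular_values {R : realType} {m n : nat} (A : 'M[R]_(m, n)) :
  set R := [set a | 0 <= a /\ eigenvalue (A *m A^T) (a ^+ 2)].
Definition smallest_singular_value {R : realType} {m n : nat}
  (A : 'M[R]_(m, n)) : R := inf (singular_values A).

Definition grad {R : realType} {n : nat} (f : 'rV[R]_n -> R) (x : 'rV[R]_n) :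
  'rV[R]_n := \row_(i < n) 'D_(delta_mx 0 i) f x.

(* The library's 'J c x acts on the right of row vectors, hence the transpose:
   entry (i, j) is the j-th partial derivative of the i-th component of c. *)
Definition jac {R : realType} {n m : nat} (c : 'rV[R]_n -> 'rV[R]_m)
  (x : 'rV[R]_n) : 'M[R]_(m, n) := ('J c x)^T.

(* J^T (J J^T)^-1, for J of full row rank *)
Definition pinv {R : realType} {m n : nat} (J : 'M[R]_(m, n)) : 'M[R]_(n, m) :=
  J^T *m invmx (J *m J^T).

Definition Pmx {R : realType} {n m : nat} (c : 'rV[R]_n -> 'rV[R]_m)
  (x : 'rV[R]_n) : 'M[R]_n := 1%:M - pinv (jac c x) *m jac c x.

Definition merit {R : realType} {n m : nat} (f : 'rV[R]_n -> R)
  (c : 'rV[R]_n -> 'rV[R]_m) (x : 'rV[R]_n) (tau : R) : R :=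
  tau * f x + norm1 (c x).

(* diag(s + eps e)^(-1/2) *)
Definition scaling {R : realType} {n : nat} (eps : R) (s : 'rV[R]_n) :
  'M[R]_n := diag_mx (\row_(i < n) (Num.sqrt (s 0 i + eps))^-1).

Definition eta {R : realType} (beta1 beta2 : R) (k : nat) : R :=
  (1 - beta1) * Num.sqrt (1 - beta2 ^+ k) / Num.sqrt (1 - beta2).

(* One run (realization) of the method on the gradient estimates g.  Iterations
   are numbered from 1; only r and s have a meaningful value at index 0. *)
Record adam_sqp_run {R : realType} {n m : nat} (c : 'rV[R]_n -> 'rV[R]_m)
    (x1 : 'rV[R]_n) (rho h : nat -> R) (beta1 beta2 alpha eps : R)
    (g x v u r s d : nat -> 'rV[R]_n) : Prop := AdamSqpRun {
  run_x1 : x 1%N = x1;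
  run_r0 : r 0%N = 0;
  run_s0 : s 0%N = 0;
  run_v : forall k, (0 < k)%N ->
    v k = - rho k *: (pinv (jac c (x k)) *v c (x k));
  run_u : forall k, (0 < k)%N -> u k = - (h k)^-1 *: (Pmx c (x k) *v g k);
  run_r : forall k, (0 < k)%N -> r k = beta1 *: r k.-1 + u k;
  run_s : forall k, (0 < k)%N -> s k = beta2 *: s k.-1 + map2_mx *%R (u k) (u k);
  run_d : forall k, (0 < k)%N ->
    d k = v k + eta beta1 beta2 k *: ((Pmx c (x k) *m scaling eps (s k)) *v r k);
  run_x : forall k, (0 < k)%N -> x k.+1 = x k + alpha *: d k
}.

(* The sigma-algebra F_k generated by g_1, ..., g_(k-1), i.e. by their
   components; the initial point is deterministic and generates nothing. *)
Definition history {R : realType} {d : measure_display}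
  {Omega : measurableType d} {n : nat} (g : nat -> Omega -> 'rV[R]_n)
  (k : nat) : set (set Omega) :=
  <<s [set A | exists (j : nat) (i : 'I_n) (B : set R),
         [/\ (0 < j < k)%N, measurable B & A = (fun w => g j w 0 i) @^-1` B]] >>.

(* Y is a version of the conditional expectation E[X | G], for G a
   sub-sigma-algebra of the measurable sets. *)
Definition is_cond_exp {R : realType} {d : measure_display}
  {Omega : measurableType d} (P : probability Omega R) (G : set (set Omega))
  (X Y : Omega -> R) : Prop :=
  [/\ P.-integrable setT (EFin \o X),
      P.-integrable setT (EFin \o Y),
      forall B : set R, measurable B -> G (Y @^-1` B) &
      forall A : set Omega, G A ->
        (\int[P]_(w in A) (X w)%:E = \int[P]_(w in A) (Y w)%:E)%E].

(* Main.v *)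
Require Import Defs.
From mathcomp Require Import all_boot all_order all_algebra.
From mathcomp Require Import all_classical all_reals all_analysis.
From mathcomp Require Import measurable_realfun.
From mathcomp Require Import ring lra.
Set Implicit Arguments.
Unset Strict Implicit.
Unset Printing Implicit Defensive.
Import Order.TTheory GRing.Theory Num.Theory.
Import numFieldNormedType.Exports.
Local Open Scope classical_set_scope.
Local Open Scope ring_scope.

(** Along every run the merit function [tau * f + norm1 c] nearly telescopes.
    The step splits orthogonally into a normal part [v k] in the range of
    [J^T], which multiplies the linearized constraint by [1 - alpha * rho k],
    and an Adam part in the kernel of [J], which leaves it unchanged.  The value
    of [tau] makes the first-order growth of [tau * f] along [v k] consume at
    most the fraction [1 - tau] of the decrease of [norm1 c], see
    [merit_decrease].

    What remains is the inner product of the projected gradient [G n] with the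
    scaled momentum.  Unrolling the momentum turns it into a geometric sum over
    lags [k] of [G n * u (n - k) / sqrt (s n + eps)], coordinate by coordinate.
    In each summand [G n] is replaced by [G (n - k)], which costs the drift of
    the gradient over [k] steps; the denominator is replaced by a surrogate
    that is determined before [u (n - k)] is drawn, the later squares
    being replaced by their uniform bound; and [u (n - k)] is recentred at its
    conditional mean [- G (n - k) / h], which produces the wanted negative
    multiple of [G (n - k) ^+ 2]: see [recentred_product_le] and
    [momentum_inner_product_le].  Apart from the squared lengths of the normal
    steps, which are uniformly bounded, the errors are multiples of
    [u ^+ 2 / (s + eps)] and [r ^+ 2 / (s + eps)], whose sums over [n] grow like
    a logarithm plus [- K * ln beta2], see [sum_normalized_sqr_le] and
    [sum_normalized_momentum_sqr_le].

    All of this holds for every outcome ([pathwise_bound]) up to the term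
    [noise], a finite sum of products of a centred variable
    [u (n - k) + G (n - k) / h] with a bounded weight that is a function of
    the earlier gradient estimates.  Such products have mean zero
    ([noise_term_mean]), so integrating the pathwise inequality proves the
    theorem; [rate_constants] does the accounting of the constants. *)

(** * Weighted geometric sums *)

Lemma sum_cauchy_schwarz (R : realDomainType) (I : Type) (r : seq I)
    (a b : I -> R) :
  (\sum_(i <- r) a i * b i) ^+ 2 <=
  (\sum_(i <- r) a i ^+ 2) * (\sum_(i <- r) b i ^+ 2).
Proof.
have distr (x y : I -> R) : (\sum_(i <- r) x i) * (\sum_(i <- r) y i) =
    \sum_(i <- r) \sum_(j <- r) x i * y j.
  by rewrite mulr_suml; apply: eq_bigr => i _; rewrite mulr_sumr.
pose A := \sum_(i <- r) a i ^+ 2; pose B := \sum_(i <- r) b i ^+ 2.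
pose C := \sum_(i <- r) a i * b i.
suff : 0 <= A * B + B * A - (C * C + C * C).
  by rewrite -/A -/B -/C expr2; lra.
have -> : A * B + B * A - (C * C + C * C) =
    \sum_(i <- r) \sum_(j <- r) (a i * b j - a j * b i) ^+ 2.
  rewrite !distr -!big_split -sumrB; apply: eq_bigr => i _ /=.
  rewrite -!big_split -sumrB; apply: eq_bigr => j _ /=; ring.
by apply: sumr_ge0 => i _; apply: sumr_ge0 => j _; exact: sqr_ge0.
Qed.

Lemma sum_geometric_le (R : realFieldType) (a : R) (N : nat) : 0 <= a < 1 ->
  \sum_(k < N) a ^+ k <= (1 - a)^-1.
Proof.
move=> /andP[a0 a1].
have a1' : 0 < 1 - a by rewrite subr_gt0.
rewrite -(ler_pM2l a1') mulfV ?gt_eqF // -opprB mulNr -subrX1 opprB.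
by rewrite gerBl exprn_ge0.
Qed.

Lemma sum_geometric_succ_le (R : realFieldType) (a : R) (N : nat) :
  0 <= a < 1 -> \sum_(k < N) a ^+ k * k.+1%:R <= (1 - a)^-2.
Proof.
move=> /andP[a0 a1].
have a1' : 0 < 1 - a by rewrite subr_gt0.
have E : (1 - a) ^+ 2 * (\sum_(k < N) a ^+ k * k.+1%:R) =
    1 - a ^+ N * (N%:R * (1 - a) + 1).
  elim: N => [|N IH]; first by rewrite big_ord0 expr0; ring.
  by rewrite big_ord_recr /= mulrDr IH (exprS a) -natr1; ring.
rewrite -(ler_pM2l (exprn_gt0 2 a1')) E mulfV ?expf_neq0 ?gt_eqF //.
by rewrite gerBl mulr_ge0 ?exprn_ge0 // addr_ge0 // mulr_ge0 // ltW.
Qed.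

Lemma sum_geometric_succ_sqr_le (R : realFieldType) (a : R) (N : nat) :
  0 <= a < 1 -> \sum_(k < N) a ^+ k * k.+1%:R ^+ 2 <= (1 + a) / (1 - a) ^+ 3.
Proof.
move=> /andP[a0 a1].
have a1' : 0 < 1 - a by rewrite subr_gt0.
have E : (1 - a) ^+ 3 * (\sum_(k < N) a ^+ k * k.+1%:R ^+ 2) =
    1 + a - a ^+ N * ((N%:R * (1 - a) + 1) ^+ 2 + a).
  elim: N => [|N IH]; first by rewrite big_ord0 expr0; ring.
  by rewrite big_ord_recr /= mulrDr IH (exprS a) -natr1; ring.
rewrite -(ler_pM2l (exprn_gt0 3 a1')) E mulrCA mulfV ?expf_neq0 ?gt_eqF //.
by rewrite mulr1 gerBl mulr_ge0 ?exprn_ge0 // addr_ge0 // sqr_ge0.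
Qed.

(** Cauchy-Schwarz with respect to the weights [a ^+ k] reduces the square root
    to the two preceding sums. *)
Lemma sum_geometric_sqrt_succ_le (R : rcfType) (a : R) (N : nat) :
  0 <= a < 1 ->
  \sum_(k < N) a ^+ k * Num.sqrt k.+1%:R <= ((1 - a) * Num.sqrt (1 - a))^-1.
Proof.
move=> a01; have /andP[a0 a1] := a01.
have a1' : 0 < 1 - a by rewrite subr_gt0.
set S := \sum_(k < N) _.
have S0 : 0 <= S by apply: sumr_ge0 => k _; rewrite mulr_ge0 ?exprn_ge0 ?sqrtr_ge0.
have T0 : 0 <= ((1 - a) * Num.sqrt (1 - a))^-1.
  by rewrite invr_ge0 mulr_ge0 ?sqrtr_ge0 // ltW.
rewrite -(@ler_pXn2r _ 2) // exprVn exprMn sqr_sqrtr ?(ltW a1') //.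
have -> : S = \sum_(k < N) Num.sqrt (a ^+ k) * (Num.sqrt (a ^+ k) * Num.sqrt k.+1%:R).
  by apply: eq_bigr => k _; rewrite mulrA -expr2 sqr_sqrtr ?exprn_ge0.
apply: le_trans (sum_cauchy_schwarz _ (fun k : 'I_N => Num.sqrt (a ^+ k))
  (fun k : 'I_N => Num.sqrt (a ^+ k) * Num.sqrt k.+1%:R)) _.
rewrite invfM [leRHS]mulrC; apply: ler_pM.
- by apply: sumr_ge0 => k _; exact: sqr_ge0.
- by apply: sumr_ge0 => k _; exact: sqr_ge0.
- apply: le_trans (sum_geometric_le N a01).
  by apply: ler_sum => k _; rewrite sqr_sqrtr ?exprn_ge0.
- apply: le_trans (sum_geometric_succ_le N a01).
  by apply: ler_sum => k _; rewrite exprMn !sqr_sqrtr ?exprn_ge0 ?ler0n.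
Qed.

Lemma sum_geometric_quot_le (R : rcfType) (a : R) (N : nat) :
  0 <= a < 1 ->
  \sum_(k < N) a ^+ k * (k%:R / Num.sqrt k.+1%:R) * k%:R <=
    a * (1 + a) / (1 - a) ^+ 3.
Proof.
move=> a01; have /andP[a0 a1] := a01.
have a1' : 0 < 1 - a by rewrite subr_gt0.
case: N => [|N].
  rewrite big_ord0 divr_ge0 ?mulr_ge0 ?exprn_ge0 ?(ltW a1') //; lra.
rewrite big_ord_recl /= mulr0 add0r -mulrA.
apply: le_trans (ler_wpM2l a0 (sum_geometric_succ_sqr_le N a01)).
rewrite mulr_sumr; apply: ler_sum => k _.
rewrite /bump leq0n add1n exprS -!mulrA; do 2 (apply: ler_wpM2l; rewrite ?exprn_ge0 //).
rewrite expr2; apply: ler_wpM2l => //.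
rewrite ler_piMl // invf_le1 ?sqrtr_gt0 // -[leLHS]sqrtr1 ler_sqrt //.
by rewrite (ler_nat _ 1).
Qed.

(** The same summand as above, with a better power of [1 - a]: after the shift
    [k = j.+1] it is at most [a ^+ j * j.+1 ^ (3 / 2)], and Cauchy-Schwarz
    splits the exponent as [1 / 2 + 1]. *)
Lemma sum_geometric_quot_sqrt_le (R : rcfType) (a : R) (N : nat) :
  0 <= a < 1 ->
  \sum_(k < N) a ^+ k * (k%:R / Num.sqrt k.+1%:R) * k%:R <=
    4 * a / ((1 - a) ^+ 2 * Num.sqrt (1 - a)).
Proof.
move=> a01; have /andP[a0 a1] := a01.
have a1' : 0 < 1 - a by rewrite subr_gt0.
have den0 : 0 < (1 - a) ^+ 2 * Num.sqrt (1 - a).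
  by rewrite mulr_gt0 ?exprn_gt0 ?sqrtr_gt0.
case: N => [|N].
  by rewrite big_ord0 divr_ge0 ?(ltW den0) ?mulr_ge0 ?ler0n.
rewrite big_ord_recl /= mulr0 add0r -mulrA mulrCA.
pose S := \sum_(k < N) a ^+ k * (Num.sqrt k.+1%:R * k.+1%:R).
have S0 : 0 <= S.
  by apply: sumr_ge0 => k _; rewrite mulr_ge0 ?exprn_ge0 ?mulr_ge0 ?sqrtr_ge0.
apply: (@le_trans _ _ (a * S)).
  rewrite mulr_sumr; apply: ler_sum => k _.
  rewrite /bump leq0n add1n exprS -!mulrA; do 2 (apply: ler_wpM2l; rewrite ?exprn_ge0 //).
  rewrite mulrA; apply: ler_wpM2r => //.
  rewrite ler_pdivrMr ?sqrtr_gt0 //; rewrite -{1}[k.+1%:R]sqr_sqrtr // expr2.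
  by rewrite ler_wpM2l ?sqrtr_ge0 // ler_sqrt // ler_nat.
apply: ler_wpM2l => //.
rewrite -(@ler_pXn2r _ 2) ?nnegrE ?divr_ge0 ?(ltW den0) //.
have -> : S = \sum_(k < N) (Num.sqrt (a ^+ k) * Num.sqrt k.+1%:R) *
                          (Num.sqrt (a ^+ k) * k.+1%:R).
  by apply: eq_bigr => k _; rewrite mulrACA -expr2 sqr_sqrtr ?exprn_ge0.
apply: le_trans (sum_cauchy_schwarz _
  (fun k : 'I_N => Num.sqrt (a ^+ k) * Num.sqrt k.+1%:R)
  (fun k : 'I_N => Num.sqrt (a ^+ k) * k.+1%:R)) _.
apply: (@le_trans _ _ ((1 - a)^-2 * ((1 + a) / (1 - a) ^+ 3))).
  apply: ler_pM.
  - by apply: sumr_ge0 => k _; exact: sqr_ge0.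
  - by apply: sumr_ge0 => k _; exact: sqr_ge0.
  - apply: le_trans (sum_geometric_succ_le N a01).
    by apply: ler_sum => k _; rewrite exprMn !sqr_sqrtr ?exprn_ge0 ?ler0n.
  - apply: le_trans (sum_geometric_succ_sqr_le N a01).
    by apply: ler_sum => k _; rewrite exprMn sqr_sqrtr ?exprn_ge0.
rewrite expr_div_n exprMn sqr_sqrtr ?(ltW a1') //.
rewrite mulrCA -invfM -exprD -exprM -exprSr.
by rewrite ler_pM2r ?invr_gt0 ?exprn_gt0 //; lra.
Qed.

(** Summed over the lag first, each [q j] meets every lag at most once. *)
Lemma sum_convolution_le (R : numDomainType) (w q : nat -> R) (W : R) (N : nat) :
  (forall k, 0 <= q k) -> (forall m, \sum_(k < m) w k <= W) ->
  \sum_(n < N) \sum_(k < n.+1) w k * q (n - k)%N <= W * \sum_(j < N) q j.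
Proof.
move=> q0 wW.
have -> : \sum_(n < N) \sum_(k < n.+1) w k * q (n - k)%N =
    \sum_(j < N) (\sum_(k < N - j) w k) * q j.
  elim: N => [|N IH]; first by rewrite !big_ord0.
  rewrite big_ord_recr /= IH.
  rewrite [in RHS]big_ord_recr /= subSn // subnn big_ord1.
  under [in RHS]eq_bigr => j _ do
    rewrite (subSn (ltnW (ltn_ord j))) big_ord_recr /= mulrDl.
  rewrite big_split /= -addrA; congr (_ + _).
  rewrite (reindex_inj rev_ord_inj) /= big_ord_recr /= subnn subn0.
  by congr (_ + _); apply: eq_bigr => k _; rewrite subSS subKn // ltnW.
by rewrite mulr_sumr; apply: ler_sum => j _; rewrite ler_wpM2r.
Qed.

Lemma sum_shift_le (R : numDomainType) (q : nat -> R) (j N : nat) :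
  (forall k, 0 <= q k) ->
  \sum_(t < N) (if (j <= t)%N then q (t - j)%N else 0) <= \sum_(t < N) q t.
Proof.
move=> q0.
have -> : \sum_(t < N) (if (j <= t)%N then q (t - j)%N else 0) =
    \sum_(t < N - j) q t.
  elim: N => [|N IH]; first by rewrite sub0n !big_ord0.
  rewrite big_ord_recr /= IH; case: leqP => [jN|Nj].
    by rewrite subSn // big_ord_recr.
  rewrite addr0; have -> : (N - j = 0)%N by apply/eqP; rewrite subn_eq0 ltnW.
  by have -> : (N.+1 - j = 0)%N by apply/eqP; rewrite subn_eq0.
rewrite (big_ord_widen N q (leq_subr j N)) big_mkcond /=.
by apply: ler_sum => t _; case: ifP.
Qed.

(** Exchanging the sums, each [q j] is counted at most [k] times for the lag
    [k]. *)
Lemma sum_lagged_window_le (R : numDomainType) (w q : nat -> R) (W : R) (N : nat) :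
  (forall k, 0 <= w k) -> (forall k, 0 <= q k) ->
  \sum_(k < N) w k * k%:R <= W ->
  \sum_(t < N) \sum_(k < t.+1) w k * \sum_(l < k) q (t - l.+1)%N <=
  W * \sum_(t < N) q t.
Proof.
move=> w0 q0 wW.
apply: le_trans (ler_wpM2r _ wW); last exact: sumr_ge0.
have E (t : 'I_N) : \sum_(k < t.+1) w k * \sum_(l < k) q (t - l.+1)%N =
    \sum_(k < N) w k * (if (k <= t)%N then \sum_(l < k) q (t - l.+1)%N else 0).
  rewrite (big_ord_widen N (fun k => w k * \sum_(l < k) q (t - l.+1)%N)) //.
  rewrite big_mkcond; apply: eq_bigr => k _ /=; rewrite ltnS.
  by case: ifP => _ //; rewrite mulr0.
under eq_bigr do rewrite E.
rewrite exchange_big mulr_suml /=; apply: ler_sum => k _.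
rewrite -mulr_sumr -mulrA; apply: ler_wpM2l => //.
apply: (@le_trans _ _ (\sum_(t < N) \sum_(l < k)
    (if (l < t)%N then q (t - l.+1)%N else 0))).
  apply: ler_sum => t _; case: ifP => kt.
    by apply: ler_sum => l _; rewrite (leq_trans (ltn_ord l) kt).
  by apply: sumr_ge0 => l _; case: ifP.
rewrite exchange_big /=.
apply: (@le_trans _ _ (\sum_(l < k) \sum_(t < N) q t)).
  by apply: ler_sum => l _; exact: sum_shift_le.
by rewrite sumr_const card_ord mulr_natl.
Qed.

(** * Exponential moving averages in one coordinate *)

Section AdamCoordinate.
Context {R : realType}.
Variables (beta1 beta2 e : R) (u r s : nat -> R).
Hypotheses (b1_ge0 : 0 <= beta1) (b12 : beta1 < beta2) (b2_lt1 : beta2 < 1).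
Hypothesis e_gt0 : 0 < e.
Hypotheses (r0 : r 0%N = 0) (s0 : s 0%N = 0).
Hypothesis rS : forall k, r k.+1 = beta1 * r k + u k.
Hypothesis sS : forall k, s k.+1 = beta2 * s k + u k ^+ 2.

Let b2_gt0 : 0 < beta2. Proof. exact: le_lt_trans b1_ge0 b12. Qed.
Let b1_lt1 : beta1 < 1. Proof. exact: lt_trans b12 b2_lt1. Qed.
Let b1' : 0 < 1 - beta1. Proof. by rewrite subr_gt0. Qed.
Let b2' : 0 < 1 - beta2. Proof. by rewrite subr_gt0. Qed.
Let q_ge0 : 0 <= beta1 / beta2. Proof. by rewrite divr_ge0 // ltW. Qed.
Let q_lt1 : beta1 / beta2 < 1. Proof. by rewrite ltr_pdivrMr // mul1r. Qed.

Lemma second_moment_ge0 k : 0 <= s k.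
Proof.
elim: k => [|k IH]; first by rewrite s0.
by rewrite sS; apply: addr_ge0 (sqr_ge0 _); apply: mulr_ge0 => //; exact: ltW.
Qed.

Let se_gt0 k : 0 < s k + e.
Proof. by rewrite ltr_wpDl ?second_moment_ge0. Qed.

Lemma first_moment_unroll k :
  r k.+1 = \sum_(i < k.+1) beta1 ^+ i * u (k - i)%N.
Proof.
elim: k => [|k IH]; first by rewrite rS r0 big_ord1 mulr0 add0r expr0 mul1r.
rewrite rS IH [RHS]big_ord_recl /= expr0 mul1r subn0 addrC; congr (_ + _).
rewrite mulr_sumr; apply: eq_bigr => i _.
by rewrite /bump leq0n add1n subSS exprS mulrA.
Qed.

Lemma second_moment_unroll n k : (k <= n)%N ->
  s n.+1 = beta2 ^+ k.+1 * s (n - k)%N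
           + \sum_(i < k.+1) beta2 ^+ i * u (n - i)%N ^+ 2.
Proof.
elim: k => [_|k IH kn].
  by rewrite big_ord1 subn0 sS expr1 expr0 mul1r.
rewrite IH ?(ltnW kn) // [in RHS]big_ord_recr /= -[in LHS](subnSK kn) sS.
by rewrite (exprSr _ k.+1); ring.
Qed.

Lemma second_moment_decay n k : (k <= n)%N ->
  beta2 ^+ k * (s (n - k).+1 + e) <= s n.+1 + e.
Proof.
elim: k => [_|k IH kn]; first by rewrite expr0 mul1r subn0.
apply: le_trans (IH (ltnW kn)).
rewrite exprSr -mulrA ler_pM2l ?exprn_gt0 // subnSK // sS.
have := sqr_ge0 (u (n - k)%N); have : beta2 * e <= e by rewrite ger_pMl // ltW.
lra.
Qed.

(** Each summand is one minus the ratio of consecutive denominators, up to the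
    factor [beta2], hence is dominated by the increment of a logarithm. *)
Lemma sum_normalized_sqr_le N :
  \sum_(k < N) u k ^+ 2 / (s k.+1 + e) <= ln (1 + s N / e) - N%:R * ln beta2.
Proof.
elim: N => [|N IH]; first by rewrite big_ord0 s0 mul0r addr0 ln1 mul0r subr0.
rewrite big_ord_recr /=; set a := u N ^+ 2.
suff step : a / (s N.+1 + e) <=
    ln (1 + s N.+1 / e) - ln (1 + s N / e) - ln beta2.
  by rewrite -(natr1 N); lra.
have E k : 1 + s k / e = (s k + e) / e by field; rewrite gt_eqF.
have p k : (s k + e) / e \is Num.pos by rewrite posrE divr_gt0.
rewrite !E !ln_div ?posrE //.
set y := beta2 * (s N + e) / (s N.+1 + e).
have y0 : 0 < y by rewrite divr_gt0 // mulr_gt0.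
have : ln (1 + (y - 1)) <= y - 1 by apply: le_ln1Dx; lra.
rewrite (_ : 1 + (y - 1) = y); last by ring.
rewrite ln_div ?posrE ?mulr_gt0 // lnM ?posrE //.
suff : a / (s N.+1 + e) <= 1 - y by lra.
rewrite -(ler_pM2r (se_gt0 N.+1)) mulrBl /y !divfK ?gt_eqF // mul1r sS -/a.
have : beta2 * e <= e by rewrite ger_pMl // ltW.
lra.
Qed.

(** A squared increment of lag [k] is measured against a denominator that is at
    least [beta2 ^+ k] times the one of its own time, which turns the rate
    [beta1] into [beta1 / beta2]. *)
Lemma sum_lagged_normalized_sqr_le (w : nat -> R) (W : R) N :
  (forall k, 0 <= w k) ->
  (forall m, \sum_(k < m) w k * (beta1 / beta2) ^+ k <= W) ->
  \sum_(n < N) \sum_(k < n.+1)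
     beta1 ^+ k * w k * (u (n - k)%N ^+ 2 / (s n.+1 + e)) <=
  W * \sum_(n < N) u n ^+ 2 / (s n.+1 + e).
Proof.
move=> w0 wW.
pose q k := u k ^+ 2 / (s k.+1 + e).
have q0 k : 0 <= q k by rewrite divr_ge0 ?sqr_ge0 // ltW.
apply: le_trans (@sum_convolution_le _
  (fun k => w k * (beta1 / beta2) ^+ k) q W N q0 wW).
apply: ler_sum => n _; apply: ler_sum => k _.
have kn : (k <= n)%N by rewrite -ltnS.
rewrite /= [_ * w k]mulrC -[leLHS]mulrA -[leRHS]mulrA; apply: ler_wpM2l => //.
rewrite expr_div_n -[leRHS]mulrA; apply: ler_wpM2l; first exact: exprn_ge0.
rewrite /q mulrCA; apply: ler_wpM2l; first exact: sqr_ge0.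
rewrite -invfM lef_pV2 ?posrE ?mulr_gt0 ?exprn_gt0 //.
exact: second_moment_decay.
Qed.

(** By Jensen for the weights [beta1 ^+ i], the square of the momentum is at
    most [(1 - beta1)^-1] times a lagged sum of squares. *)
Lemma sum_normalized_momentum_sqr_le N :
  \sum_(k < N) r k.+1 ^+ 2 / (s k.+1 + e) <=
  ((1 - beta1) * (1 - beta1 / beta2))^-1 *
    \sum_(k < N) u k ^+ 2 / (s k.+1 + e).
Proof.
have q' : 0 < 1 - beta1 / beta2 by rewrite subr_gt0.
have H := @sum_lagged_normalized_sqr_le (fun=> 1) (1 - beta1 / beta2)^-1 N.
rewrite invfM -mulrA.
apply: le_trans (ler_wpM2l _ (H _ _)); rewrite ?invr_ge0 ?(ltW b1') //; last first.
  move=> m; under eq_bigr do rewrite mul1r.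
  by apply: sum_geometric_le; rewrite q_ge0.
rewrite mulr_sumr; apply: ler_sum => n _.
under eq_bigr do rewrite mulr1 mulrA.
rewrite -mulr_suml mulrA; apply: ler_wpM2r; first by rewrite invr_ge0 ltW.
rewrite first_moment_unroll.
have -> : \sum_(i < n.+1) beta1 ^+ i * u (n - i)%N =
    \sum_(i < n.+1) Num.sqrt (beta1 ^+ i) * (Num.sqrt (beta1 ^+ i) * u (n - i)%N).
  by apply: eq_bigr => i _; rewrite mulrA -expr2 sqr_sqrtr ?exprn_ge0.
apply: le_trans (sum_cauchy_schwarz _ (fun i : 'I_n.+1 => Num.sqrt (beta1 ^+ i))
  (fun i : 'I_n.+1 => Num.sqrt (beta1 ^+ i) * u (n - i)%N)) _.
under eq_bigr do rewrite sqr_sqrtr ?exprn_ge0 //.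
under [X in _ * X]eq_bigr do rewrite exprMn sqr_sqrtr ?exprn_ge0 //.
apply: ler_wpM2r; last by apply: sum_geometric_le; rewrite b1_ge0.
by apply: sumr_ge0 => i _; rewrite mulr_ge0 ?sqr_ge0 ?exprn_ge0.
Qed.

(** Replacing a denominator [s + e] by a larger one [t + e] costs only terms
    that are quadratic in [v] relative to the original denominator.  Recentring
    [v] at [- G / h] frees the term [- G ^+ 2 / _], half of which pays for the
    change of denominator. *)
Lemma recentred_product_le (Gn G v sn t h D th : R) :
  0 <= sn -> sn <= t -> 0 <= D -> t - sn <= D ^+ 2 -> D ^+ 2 <= t + e ->
  0 < h -> 0 < th ->
  Gn * v / Num.sqrt (sn + e) <=
    G * (v + G / h) / Num.sqrt (t + e)
    - G ^+ 2 / (2 * h * Num.sqrt (t + e))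
    + th * (Gn - G) ^+ 2
    + ((4 * th)^-1 + h * D / 2) * (v ^+ 2 / (sn + e)).
Proof.
move=> sn0 snt D0 gap Dt h0 th0.
have a0 : 0 < sn + e by rewrite ltr_wpDl.
have b0 : 0 < t + e by rewrite ltr_wpDl // (le_trans sn0).
pose A := Num.sqrt (sn + e); pose B := Num.sqrt (t + e).
have A0 : 0 < A by rewrite sqrtr_gt0.
have B0 : 0 < B by rewrite sqrtr_gt0.
have AE : A ^+ 2 = sn + e by rewrite sqr_sqrtr // ltW.
have BE : B ^+ 2 = t + e by rewrite sqr_sqrtr // ltW.
pose p := A^-1; pose q := B^-1.
have p0 : 0 < p by rewrite invr_gt0.
have q0 : 0 < q by rewrite invr_gt0.
have AB : A <= B by rewrite ler_sqrt ?lerD2r // ltW.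
have ABs := ltW (addr_gt0 A0 B0).
have pq0 : 0 <= p - q by rewrite subr_ge0 lef_pV2 ?posrE.
have Dq0 : 0 <= D * q by rewrite mulr_ge0 // ltW.
have Dq1 : D * q <= 1.
  rewrite ler_pdivrMr // mul1r -(@ler_pXn2r _ 2) ?nnegrE ?(ltW B0) //.
  by rewrite BE.
have pqD : p - q <= D ^+ 2 * p * q ^+ 2.
  have -> : p - q = (B ^+ 2 - A ^+ 2) * p * q / (A + B).
    by rewrite /p /q; field; rewrite !gt_eqF ?addr_gt0.
  apply: (@le_trans _ _ (D ^+ 2 * p * q / (A + B))).
    rewrite ler_wpM2r ?invr_ge0 //.
    rewrite ler_wpM2r ?(ltW q0) // ler_wpM2r ?(ltW p0) //.
    by rewrite AE BE; move: gap; lra.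
  rewrite expr2 [leRHS]mulrA ler_wpM2l ?mulr_ge0 ?sqr_ge0 ?(ltW p0) ?(ltW q0) //.
  by rewrite lef_pV2 ?posrE ?addr_gt0 // lerDr ltW.
have -> : v ^+ 2 / (sn + e) = (v * p) ^+ 2 by rewrite exprMn /p exprVn AE.
have -> : G ^+ 2 / (2 * h * B) = G ^+ 2 * q / (2 * h).
  by rewrite /q; field; rewrite !gt_eqF.
rewrite -/A -/B -/p -/q.
have split : Gn * v * p =
    (Gn - G) * (v * p) + G * v * q + G * v * (p - q) by ring.
(* Young's inequality, weighted by [th] *)
have first : (Gn - G) * (v * p) <= th * (Gn - G) ^+ 2 + (4 * th)^-1 * (v * p) ^+ 2.
  rewrite -subr_ge0 (_ : _ - _ = (2 * th * (Gn - G) - v * p) ^+ 2 / (4 * th)).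
    by rewrite divr_ge0 ?sqr_ge0 // mulr_ge0 // ltW.
  by field; rewrite gt_eqF.
(* Young's inequality with weight [q / h]; three factors [D * q <= 1] absorb
   all but one power of [D] *)
have second : G * v * (p - q) <=
    G ^+ 2 * q / (2 * h) + h * D / 2 * (v * p) ^+ 2.
  apply: le_trans (ler_norm _) _; rewrite normrM (ger0_norm pq0) normrM.
  apply: le_trans (ler_wpM2l _ pqD) _; first by rewrite mulr_ge0.
  have -> : G ^+ 2 = `|G| ^+ 2 by rewrite real_normK ?num_real.
  have -> : (v * p) ^+ 2 = (`|v| * p) ^+ 2.
    by rewrite !exprMn real_normK ?num_real.
  set g := `|G|; set a := `|v| * p.
  apply: (@le_trans _ _ (g ^+ 2 * q / (2 * h) + h / 2 * (D * a) ^+ 2 * q * (D * q) ^+ 2)).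
    rewrite -subr_ge0 (_ : _ - _ = q / (2 * h) * (g - h * (D * a) * (D * q)) ^+ 2).
      by rewrite mulr_ge0 ?sqr_ge0 // divr_ge0 ?mulr_ge0 // ltW.
    by rewrite /a; set z := `|v|; field; rewrite gt_eqF.
  rewrite lerD2l.
  have -> : h / 2 * (D * a) ^+ 2 * q * (D * q) ^+ 2 =
      h * D / 2 * a ^+ 2 * (D * q) ^+ 3 by ring.
  rewrite ler_piMr ?exprn_ile1 //.
  by rewrite mulr_ge0 ?sqr_ge0 // divr_ge0 ?mulr_ge0 // ltW.
have third : G * (v + G / h) * q = G * v * q + 2 * (G ^+ 2 * q / (2 * h)).
  by field; rewrite gt_eqF.
rewrite split third mulrDl; move: first second; lra.
Qed.

Variables (G h : nat -> R) (S hmin hmax : R).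
Hypotheses (S_gt0 : 0 < S) (hmin_gt0 : 0 < hmin).
Hypothesis h_bnd : forall k, hmin <= h k <= hmax.
Hypothesis u_bnd : forall k, u k ^+ 2 <= (S / hmin) ^+ 2 - e.

(** Dominates [s n.+1] but depends only on [s (n - k)]: the [k.+1] squared
    increments that enter after time [n - k] are replaced by their common
    bound. *)
Definition surrogate (n k : nat) : R :=
  beta2 ^+ k.+1 * s (n - k)%N
  + ((S / hmin) ^+ 2 - e) * \sum_(i < k.+1) beta2 ^+ i.

Let hmax_gt0 : 0 < hmax.
Proof. by have /andP[/(lt_le_trans hmin_gt0)/lt_le_trans h1 /h1] := h_bnd 0. Qed.
Let B_ge0 : 0 <= (S / hmin) ^+ 2 - e.
Proof. exact: le_trans (sqr_ge0 _) (u_bnd 0). Qed.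

Lemma second_moment_le k :
  s k <= ((S / hmin) ^+ 2 - e) * ((1 - beta2 ^+ k) / (1 - beta2)).
Proof.
elim: k => [|k IH]; first by rewrite s0 expr0 subrr mul0r mulr0.
rewrite sS; apply: le_trans (lerD (ler_wpM2l (ltW b2_gt0) IH) (u_bnd k)) _.
rewrite le_eqVlt; apply/orP; left; apply/eqP; rewrite (exprS beta2).
by field; rewrite !gt_eqF.
Qed.

Let geomE k : \sum_(i < k) beta2 ^+ i = (1 - beta2 ^+ k) / (1 - beta2).
Proof.
apply: (mulIf (lt0r_neq0 b2')); rewrite divfK ?gt_eqF //.
by rewrite mulrC -opprB mulNr -subrX1 opprB.
Qed.

Lemma second_moment_le_surrogate n k : (k <= n)%N -> s n.+1 <= surrogate n k.
Proof.
move=> kn; rewrite (second_moment_unroll kn) /surrogate lerD2l mulr_sumr.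
by apply: ler_sum => i _; rewrite mulrC ler_wpM2r ?exprn_ge0 // ltW.
Qed.

Lemma surrogate_gap n k : (k <= n)%N ->
  surrogate n k - s n.+1 <= ((S / hmin) ^+ 2 - e) * \sum_(i < k.+1) beta2 ^+ i.
Proof.
move=> kn; rewrite (second_moment_unroll kn) /surrogate.
set X := beta2 ^+ _ * _; set Y := _ * \sum_(i < _) _.
suff : 0 <= \sum_(i < k.+1) beta2 ^+ i * u (n - i)%N ^+ 2 by lra.
by apply: sumr_ge0 => i _; rewrite mulr_ge0 ?sqr_ge0 ?exprn_ge0 // ltW.
Qed.

(** The factor [1 - beta2 ^+ n.+1] is the one that the numerator of [eta]
    cancels. *)
Lemma surrogate_le n k : (k <= n)%N ->
  surrogate n k + e <= (S / hmin) ^+ 2 * ((1 - beta2 ^+ n.+1) / (1 - beta2)).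
Proof.
move=> kn; rewrite /surrogate geomE.
set B := (S / hmin) ^+ 2 - e.
have H : beta2 ^+ k.+1 * s (n - k)%N <=
    beta2 ^+ k.+1 * (B * ((1 - beta2 ^+ (n - k)) / (1 - beta2))).
  by rewrite ler_wpM2l ?exprn_ge0 ?second_moment_le // ltW.
have E : beta2 ^+ n.+1 = beta2 ^+ k.+1 * beta2 ^+ (n - k).
  by rewrite -exprD addSn subnKC.
have -> : (S / hmin) ^+ 2 = B + e by rewrite /B subrK.
have F : B * ((1 - beta2 ^+ n.+1) / (1 - beta2)) =
    beta2 ^+ k.+1 * (B * ((1 - beta2 ^+ (n - k)) / (1 - beta2))) +
    B * ((1 - beta2 ^+ k.+1) / (1 - beta2)).
  by rewrite E; field; rewrite !gt_eqF.
rewrite [(B + e) * _]mulrDl F; apply: lerD; first by rewrite lerD2r.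
rewrite ler_peMr ?(ltW e_gt0) // ler_pdivlMr // mul1r lerD2l lerN2.
by rewrite (exprS beta2) ler_piMr ?exprn_ile1 // ltW.
Qed.

(** Combines the recentring over all lags: of the nonpositive terms
    [- G ^+ 2 / _] only the one of lag zero is kept. *)
Lemma momentum_inner_product_le N (etab := (1 - beta1) / Num.sqrt (1 - beta2)) :
  \sum_(n < N) eta beta1 beta2 n.+1 * (G n * r n.+1 / Num.sqrt (s n.+1 + e)) <=
  \sum_(n < N) \sum_(k < n.+1) eta beta1 beta2 n.+1 * beta1 ^+ k *
     (G (n - k)%N * (u (n - k)%N + G (n - k)%N / h (n - k)%N)
        / Num.sqrt (surrogate n k + e))
  - hmin * (1 - beta1) / (2 * hmax * S) * \sum_(n < N) G n ^+ 2
  + etab * (Num.sqrt (1 - beta1) / (4 * S)) *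
      (\sum_(n < N) \sum_(k < n.+1)
         beta1 ^+ k / Num.sqrt k.+1%:R * (G n - G (n - k)%N) ^+ 2)
  + etab * (3 / 2 * S * (hmax / hmin) / Num.sqrt (1 - beta1)) *
      ((1 - beta1 / beta2) * Num.sqrt (1 - beta1 / beta2))^-1 *
      \sum_(n < N) u n ^+ 2 / (s n.+1 + e).
Proof.
have sb1 : 0 < Num.sqrt (1 - beta1) by rewrite sqrtr_gt0.
have sb2 : 0 < Num.sqrt (1 - beta2) by rewrite sqrtr_gt0.
have eta_ge0 n : 0 <= eta beta1 beta2 n.
  by rewrite /eta divr_ge0 ?mulr_ge0 ?sqrtr_ge0 // ltW.
have eta_le n : eta beta1 beta2 n <= etab.
  rewrite /eta /etab ler_wpM2r ?invr_ge0 ?sqrtr_ge0 // ler_piMr ?(ltW b1') //.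
  by rewrite -[leRHS]sqrtr1 ler_sqrt // gerBl exprn_ge0 // ltW.
have etab_ge0 : 0 <= etab by rewrite divr_ge0 ?sqrtr_ge0 // ltW.
pose C := 3 / 2 * S * (hmax / hmin) / Num.sqrt (1 - beta1).
have C0 : 0 <= C.
  by rewrite /C !(divr_ge0, mulr_ge0) ?sqrtr_ge0 ?(ltW S_gt0) ?(ltW hmax_gt0)
    ?(ltW hmin_gt0).
pose q n k := u (n - k)%N ^+ 2 / (s n.+1 + e).
have q_ge0' n k : 0 <= q n k by rewrite divr_ge0 ?sqr_ge0 // ltW.
pose MD n k := G (n - k)%N * (u (n - k)%N + G (n - k)%N / h (n - k)%N)
        / Num.sqrt (surrogate n k + e).
(* with this weight the Young term of the drift grows like [sqrt k.+1] in the
   lag, as does the cost [D] of the surrogate *)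
pose th k := Num.sqrt (1 - beta1) / (4 * S) / Num.sqrt k.+1%:R.
have sk k : 0 < Num.sqrt k.+1%:R :> R by rewrite sqrtr_gt0 ltr0n.
have h_gt0 k : 0 < h k by have /andP[/(lt_le_trans hmin_gt0)] := h_bnd k.
have sur_gt0 n k : (k <= n)%N -> 0 < surrogate n k + e.
  move=> kn; apply: lt_le_trans (se_gt0 n.+1) _.
  by rewrite lerD2r second_moment_le_surrogate.
have term n k : (k <= n)%N ->
  G n * u (n - k)%N / Num.sqrt (s n.+1 + e) <=
  MD n k - G (n - k)%N ^+ 2 / (2 * h (n - k)%N * Num.sqrt (surrogate n k + e))
  + th k * (G n - G (n - k)%N) ^+ 2 + C * Num.sqrt k.+1%:R * q n k.
  move=> kn.
  pose D := Num.sqrt (((S / hmin) ^+ 2 - e) * \sum_(i < k.+1) beta2 ^+ i).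
  have D2 : D ^+ 2 = ((S / hmin) ^+ 2 - e) * \sum_(i < k.+1) beta2 ^+ i.
    rewrite sqr_sqrtr // mulr_ge0 // sumr_ge0 // => i _.
    by rewrite exprn_ge0 // ltW.
  have th0 : 0 < th k by rewrite !divr_gt0 // mulr_gt0.
  apply: le_trans (@recentred_product_le _ (G (n - k)%N) _ (s n.+1)
    (surrogate n k) (h (n - k)%N) D (th k) _ _ _ _ _ _ _) _ => //.
  - exact: second_moment_ge0.
  - exact: second_moment_le_surrogate.
  - exact: sqrtr_ge0.
  - by rewrite D2 surrogate_gap.
  - rewrite D2 /surrogate -addrA [X in _ <= _ + X]addrC addrA lerDr.
    by rewrite addr_ge0 ?(ltW e_gt0) // mulr_ge0 ?exprn_ge0 ?(ltW b2_gt0)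
      ?second_moment_ge0.
  rewrite lerD2l; apply: ler_wpM2r; first exact: q_ge0'.
  have D_le : D <= Num.sqrt k.+1%:R * (S / hmin).
    rewrite -(@ler_pXn2r _ 2) ?nnegrE ?sqrtr_ge0 //; last first.
      by rewrite mulr_ge0 ?sqrtr_ge0 // divr_ge0 // ltW.
    rewrite D2 [(Num.sqrt _ * _) ^+ 2]exprMn sqr_sqrtr ?ler0n // mulrC; apply: ler_pM => //.
    - by rewrite sumr_ge0 // => i _; rewrite exprn_ge0 // ltW.
    - rewrite -[k.+1 in leRHS]card_ord -sum1_card natr_sum; apply: ler_sum => i _.
      by rewrite exprn_ile1 // ltW.
    - by rewrite gerBl ltW.
  have -> : (4 * th k)^-1 = S / Num.sqrt (1 - beta1) * Num.sqrt k.+1%:R.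
    by rewrite /th; field; rewrite !gt_eqF.
  have hD : h (n - k)%N * D <=
      hmax / hmin * S / Num.sqrt (1 - beta1) * Num.sqrt k.+1%:R.
    apply: (@le_trans _ _ (hmax * (Num.sqrt k.+1%:R * (S / hmin)))).
      apply: ler_pM; rewrite ?sqrtr_ge0 ?(ltW (h_gt0 _)) //.
      by have /andP[] := h_bnd (n - k)%N.
    rewrite [leRHS](_ : _ =
        (hmax * (Num.sqrt k.+1%:R * (S / hmin))) / Num.sqrt (1 - beta1)).
      rewrite ler_peMr //.
        by rewrite !mulr_ge0 ?sqrtr_ge0 ?invr_ge0 // ltW.
      by rewrite invf_ge1 // -[leRHS]sqrtr1 ler_sqrt // gerBl.
    by field; rewrite !gt_eqF.
  have hS : S / Num.sqrt (1 - beta1) * Num.sqrt k.+1%:R <=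
      hmax / hmin * S / Num.sqrt (1 - beta1) * Num.sqrt k.+1%:R.
    rewrite -!mulrA [leRHS]mulrA ler_peMl //.
      by rewrite !mulr_ge0 ?sqrtr_ge0 ?invr_ge0 ?sqrtr_ge0 // ltW.
    rewrite ler_pdivlMr // mul1r.
    by have /andP[h1 h2] := h_bnd 0; apply: le_trans h2.
  rewrite (_ : C * _ = 3 / 2 *
      (hmax / hmin * S / Num.sqrt (1 - beta1) * Num.sqrt k.+1%:R)).
    by move: hD hS; lra.
  by rewrite /C; field; rewrite !gt_eqF.
have sum_term n :
  eta beta1 beta2 n.+1 * (G n * r n.+1 / Num.sqrt (s n.+1 + e)) <=
  \sum_(k < n.+1) eta beta1 beta2 n.+1 * beta1 ^+ k * MD n k
  - hmin * (1 - beta1) / (2 * hmax * S) * G n ^+ 2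
  + etab * (\sum_(k < n.+1) beta1 ^+ k * (th k * (G n - G (n - k)%N) ^+ 2))
  + etab * (\sum_(k < n.+1) beta1 ^+ k * (C * Num.sqrt k.+1%:R * q n k)).
  have -> : G n * r n.+1 / Num.sqrt (s n.+1 + e) =
      \sum_(k < n.+1) beta1 ^+ k * (G n * u (n - k)%N / Num.sqrt (s n.+1 + e)).
    rewrite first_moment_unroll mulr_sumr mulr_suml; apply: eq_bigr => k _.
    by ring.
  pose Q k := G (n - k)%N ^+ 2 / (2 * h (n - k)%N * Num.sqrt (surrogate n k + e)).
  pose T k := th k * (G n - G (n - k)%N) ^+ 2.
  pose V k := C * Num.sqrt k.+1%:R * q n k.
  have Q_ge0 k : 0 <= Q k.
    rewrite divr_ge0 ?sqr_ge0 // mulr_ge0 ?sqrtr_ge0 // mulr_ge0 //.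
    exact/ltW/h_gt0.
  have T_ge0 k : 0 <= T k.
    by rewrite mulr_ge0 ?sqr_ge0 // !divr_ge0 ?sqrtr_ge0 ?mulr_ge0 // ltW.
  have V_ge0 k : 0 <= V k.
    by rewrite mulr_ge0 // mulr_ge0 ?sqrtr_ge0.
  have bsum (F : nat -> R) : (forall k, 0 <= F k) ->
      0 <= \sum_(k < n.+1) beta1 ^+ k * F k.
    by move=> F0; apply: sumr_ge0 => k _; rewrite mulr_ge0 ?exprn_ge0.
  (* the bias correction in [eta] cancels the growth of the surrogate *)
  have lag0 : hmin * (1 - beta1) / (2 * hmax * S) * G n ^+ 2 <=
      eta beta1 beta2 n.+1 * \sum_(k < n.+1) beta1 ^+ k * Q k.
    rewrite big_ord_recl /= expr0 mul1r [leRHS]mulrDr.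
    apply: ler_wpDr.
      rewrite mulr_ge0 // sumr_ge0 // => k _.
      by rewrite mulr_ge0 ?exprn_ge0.
    rewrite /Q subn0 [leLHS]mulrC [leRHS]mulrCA; apply: ler_wpM2l; first exact: sqr_ge0.
    have hZ := h_gt0 n; have Z0 := sur_gt0 n 0%N (leq0n n).
    rewrite ler_pdivlMr; last by rewrite !mulr_gt0 ?sqrtr_gt0.
    pose x := Num.sqrt (1 - beta2 ^+ n.+1); pose y := Num.sqrt (1 - beta2).
    have x0 : 0 <= x by exact: sqrtr_ge0.
    have Z_le : Num.sqrt (surrogate n 0 + e) <= S / hmin * (x / y).
      have xyE : x / y = Num.sqrt ((1 - beta2 ^+ n.+1) / (1 - beta2)).
        by rewrite sqrtrM ?sqrtrV // ?(ltW b2') // subr_ge0 exprn_ile1 // ltW.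
      rewrite -[S / hmin]ger0_norm ?divr_ge0 ?(ltW S_gt0) ?(ltW hmin_gt0) //.
      rewrite -sqrtr_sqr xyE -sqrtrM ?sqr_ge0 //.
      exact/ler_wsqrtr/surrogate_le.
    have hle : h n <= hmax by have /andP[] := h_bnd n.
    have := ler_pM (ltW hZ) (sqrtr_ge0 _) hle Z_le.
    set Z := Num.sqrt _ => hZle.
    apply: (@le_trans _ _ (hmin * (1 - beta1) / (2 * hmax * S) *
        (2 * (hmax * (S / hmin * (x / y)))))).
      rewrite -(mulrA 2 (h n)); apply: ler_wpM2l; last by rewrite ler_pM2l.
      by rewrite !(divr_ge0, mulr_ge0) ?(ltW S_gt0) ?(ltW hmax_gt0)
        ?(ltW hmin_gt0) ?(ltW b1').
    rewrite /eta -/x -/y le_eqVlt; apply/orP; left; apply/eqP.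
    by field; rewrite !gt_eqF.
  apply: (@le_trans _ _ (eta beta1 beta2 n.+1 *
      \sum_(k < n.+1) beta1 ^+ k * (MD n k - Q k + T k + V k))).
    apply: ler_wpM2l => //; apply: ler_sum => k _.
    by apply: ler_wpM2l; rewrite ?exprn_ge0 //; apply: term; rewrite -ltnS.
  have -> : \sum_(k < n.+1) beta1 ^+ k * (MD n k - Q k + T k + V k) =
      \sum_(k < n.+1) beta1 ^+ k * MD n k - \sum_(k < n.+1) beta1 ^+ k * Q k
      + \sum_(k < n.+1) beta1 ^+ k * T k + \sum_(k < n.+1) beta1 ^+ k * V k.
    by rewrite -sumrB -!big_split; apply: eq_bigr => k _ /=; rewrite !mulrDr mulrN.
  rewrite [leLHS]mulrDr [X in X + _ <= _]mulrDr [X in X + _ + _ <= _]mulrDr mulrN.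
  apply: lerD; last by rewrite ler_wpM2r ?bsum.
  apply: lerD; last by rewrite ler_wpM2r ?bsum.
  rewrite mulr_sumr; under eq_bigr do rewrite mulrA.
  by rewrite lerD2l lerN2.
apply: le_trans (ler_sum _ (fun n _ => sum_term (nat_of_ord n))) _.
rewrite !big_split /= sumrN -!mulr_sumr -!addrA lerD2l lerD2l.
apply: lerD.
  rewrite -mulrA ler_wpM2l // mulr_sumr ler_sum // => n _.
  rewrite mulr_sumr ler_sum // => k _; rewrite /th.
  rewrite le_eqVlt; apply/orP; left; apply/eqP; ring.
rewrite -/C -2!(mulrA etab); apply: ler_wpM2l => //.
have H := @sum_lagged_normalized_sqr_le (fun k => Num.sqrt k.+1%:R)
  ((1 - beta1 / beta2) * Num.sqrt (1 - beta1 / beta2))^-1 N.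
rewrite -(mulrA C); apply: le_trans (ler_wpM2l C0 (H _ _)).
- rewrite mulr_sumr ler_sum // => n _; rewrite mulr_sumr ler_sum // => k _.
  rewrite le_eqVlt; apply/orP; left; apply/eqP; rewrite /q; ring.
- by move=> k; exact: sqrtr_ge0.
- move=> m; under eq_bigr do rewrite mulrC.
  by apply: sum_geometric_sqrt_succ_le; rewrite q_ge0.
Qed.
End AdamCoordinate.

(** * Euclidean geometry of the null-space projector *)

Section Euclidean.
Context {R : realType}.
Implicit Types n m : nat.

Definition dotv n (x y : 'rV[R]_n) : R := \sum_(i < n) x 0 i * y 0 i.

Lemma dotvE n (x y : 'rV[R]_n) : dotv x y = (x *m y^T) 0 0.
Proof. by rewrite mxE; apply: eq_bigr => i _; rewrite mxE. Qed.

Lemma dotvC n (x y : 'rV[R]_n) : dotv x y = dotv y x.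
Proof. by apply: eq_bigr => i _; rewrite mulrC. Qed.

Lemma dotvDl n (x y z : 'rV[R]_n) : dotv (x + y) z = dotv x z + dotv y z.
Proof. by rewrite !dotvE mulmxDl mxE. Qed.

Lemma dotvDr n (x y z : 'rV[R]_n) : dotv z (x + y) = dotv z x + dotv z y.
Proof. by rewrite dotvC dotvDl !(dotvC _ z). Qed.

Lemma dotvZl n a (x y : 'rV[R]_n) : dotv (a *: x) y = a * dotv x y.
Proof. by rewrite !dotvE -scalemxAl mxE. Qed.

Lemma dotvZr n a (x y : 'rV[R]_n) : dotv x (a *: y) = a * dotv x y.
Proof. by rewrite dotvC dotvZl dotvC. Qed.

Lemma dotv_ge0 n (x : 'rV[R]_n) : 0 <= dotv x x.
Proof. by apply: sumr_ge0 => i _; rewrite -expr2 sqr_ge0. Qed.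

Lemma dotv_eq0 n (x : 'rV[R]_n) : dotv x x = 0 -> x = 0.
Proof.
move=> /psumr_eq0P H; apply/rowP => i; rewrite mxE.
apply/eqP; rewrite -sqrf_eq0 expr2; apply/eqP/H => // j _.
by rewrite -expr2 sqr_ge0.
Qed.

Lemma sqr_norm2 n (x : 'rV[R]_n) : norm2 x ^+ 2 = dotv x x.
Proof.
rewrite /norm2 sqr_sqrtr; first by apply: eq_bigr => i _; rewrite expr2.
by apply: sumr_ge0 => i _; exact: sqr_ge0.
Qed.

Lemma norm2_ge0 n (x : 'rV[R]_n) : 0 <= norm2 x.
Proof. exact: sqrtr_ge0. Qed.

Lemma norm2Z n a (x : 'rV[R]_n) : norm2 (a *: x) = `|a| * norm2 x.
Proof.
apply/eqP; rewrite -(@eqrXn2 _ 2) ?mulr_ge0 ?norm2_ge0 //; apply/eqP.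
by rewrite exprMn real_normK ?num_real // !sqr_norm2 dotvZl dotvZr mulrA expr2.
Qed.

Lemma dotv_le_norm2 n (x y : 'rV[R]_n) : dotv x y <= norm2 x * norm2 y.
Proof.
apply: le_trans (ler_norm _) _.
rewrite -(@ler_pXn2r _ 2) ?nnegrE ?mulr_ge0 ?norm2_ge0 //.
rewrite real_normK ?num_real // exprMn !sqr_norm2.
by apply: le_trans (sum_cauchy_schwarz _ _ _) _.
Qed.

Lemma norm2_le_norm1 n (x : 'rV[R]_n) : norm2 x <= norm1 x.
Proof.
have n1 : 0 <= norm1 x by apply: sumr_ge0.
rewrite -(@ler_pXn2r _ 2) ?nnegrE ?norm2_ge0 // sqr_norm2.
rewrite expr2 /norm1 mulr_suml; apply: ler_sum => i _.
rewrite -(ger0_norm (_ : 0 <= x 0 i * x 0 i)) -?expr2 ?sqr_ge0 // expr2 normrM.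
by apply: ler_wpM2l => //; rewrite (bigD1 i) //= lerDl sumr_ge0.
Qed.

Lemma dotv_mxact n m (A : 'M[R]_(m, n)) x y : dotv (A *v x) y = dotv x (A^T *v y).
Proof. by rewrite !dotvE /mxact trmxK trmx_mul mulmxA. Qed.

Lemma mxactM n m p (A : 'M[R]_(m, n)) (B : 'M[R]_(n, p)) x :
  (A *m B) *v x = A *v (B *v x).
Proof. by rewrite /mxact trmx_mul mulmxA. Qed.

Lemma mxactD n m (A : 'M[R]_(m, n)) x y : A *v (x + y) = A *v x + A *v y.
Proof. by rewrite /mxact mulmxDl. Qed.

Lemma mxactZ n m (A : 'M[R]_(m, n)) a x : A *v (a *: x) = a *: (A *v x).
Proof. by rewrite /mxact -scalemxAl. Qed.

Lemma quadratic_ge0_linear_eq0 (a b : R) :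
  (forall t, 0 <= 2 * (t * b) + t ^+ 2 * a) -> b = 0.
Proof.
move=> H; have a0 : 0 <= a by move: (H 1) (H (-1)); rewrite sqrrN expr1n; lra.
have a1 : 0 < a + 1 by lra.
have := H (- b / (a + 1)).
have -> : 2 * (- b / (a + 1) * b) + (- b / (a + 1)) ^+ 2 * a =
    - (b ^+ 2 * ((a + 2) / (a + 1) ^+ 2)) by field; rewrite gt_eqF.
rewrite oppr_ge0 pmulr_lle0; last by rewrite divr_gt0 ?exprn_gt0 //; lra.
by move=> b0; apply/eqP; rewrite -sqrf_eq0 eq_le b0 sqr_ge0.
Qed.

Lemma continuous_sumr (T : topologicalType) (I : Type) (r : seq I)
    (g : I -> T -> R) :
  (forall i, continuous (g i)) -> continuous (fun z => \sum_(i <- r) g i z).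
Proof.
move=> gc z; elim: r => [|i r IH].
  under eq_fun do rewrite big_nil.
  exact: cvg_cst.
under eq_fun do rewrite big_cons.
by apply: cvgD => //; exact: gc.
Qed.

(** The minimum of the Rayleigh quotient of [A A^T] is attained on the unit
    sphere, and a minimizer is an eigenvector. *)
Lemma smallest_singular_value_le n m (A : 'M[R]_(m, n)) (y : 'rV[R]_m) :
  smallest_singular_value A * norm2 y <= norm2 (A^T *v y).
Proof.
have [->|y0] := eqVneq y 0.
  by rewrite -(scale0r 0) norm2Z normr0 mul0r mulr0 norm2_ge0.
pose f (z : 'rV[R]_m) := dotv (A^T *v z) (A^T *v z).
pose D := [set z : 'rV[R]_m | dotv z z = 1].
have coord_cont i : continuous (fun z : 'rV[R]_m => z 0 i).
  exact: coord_continuous.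
have dot_cont p (g h : 'rV[R]_m -> 'rV[R]_p) :
    (forall i, continuous (fun z => g z 0 i)) ->
    (forall i, continuous (fun z => h z 0 i)) ->
    continuous (fun z => dotv (g z) (h z)).
  move=> gc hc; apply: continuous_sumr => i z.
  exact: (continuousM (gc i z) (hc i z)).
have Ac i : continuous (fun z : 'rV[R]_m => (A^T *v z) 0 i).
  rewrite (_ : (fun z => _) = (fun z : 'rV[R]_m => \sum_j z 0 j * A j i)).
    apply: continuous_sumr => j z.
    exact: (continuousM (coord_cont j z) (@cst_continuous _ _ (A j i) z)).
  by apply/funext => z; rewrite /mxact trmxK mxE.
have f_cont : continuous f by exact: dot_cont.
have y2 : 0 < norm2 y.
  rewrite lt_neqAle norm2_ge0 andbT eq_sym; apply: contra_neq y0 => y0.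
  by apply: dotv_eq0; rewrite -sqr_norm2 y0 expr0n.
have D_cpt : compact D.
  apply: bounded_closed_compact; last first.
    rewrite (_ : D = (fun z => dotv z z) @^-1` [set 1]) //.
    apply: preimage_closed; last exact: closed_eq.
    by move=> z _; exact: dot_cont.
  exists 1; split => // b b1 z Dz; rewrite /Num.norm /= mx_normrE.
  apply/bigmax_leP; split; first by lra.
  move=> [i j] _ /=; rewrite (ord1 i); apply: le_trans (ltW b1).
  rewrite -(@ler_pXn2r _ 2) ?nnegrE // expr1n real_normK ?num_real // -Dz.
  rewrite /dotv (bigD1 j) //= -expr2 lerDl; apply: sumr_ge0 => k _.
  by rewrite -expr2 sqr_ge0.
have D_n0 : D !=set0.
  exists ((norm2 y)^-1 *: y); rewrite /D /= dotvZl dotvZr -sqr_norm2.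
  by field; rewrite gt_eqF.
have [z Dz zmin] := EVT_min_rV D_n0 D_cpt (continuous_subspaceT f_cont).
move: Dz; rewrite inE => Dz.
pose l := f z.
have l0 : 0 <= l by exact: dotv_ge0.
have fZ a x : f (a *: x) = a ^+ 2 * f x.
  by rewrite /f mxactZ dotvZl dotvZr mulrA expr2.
have fmin x : 0 <= f x - l * dotv x x.
  have [->|x0] := eqVneq x 0.
    rewrite -(scale0r (0 : 'rV[R]_m)) fZ dotvZl expr0n !mul0r mulr0 subrr //.
  have x2 : 0 < norm2 x.
    rewrite lt_neqAle norm2_ge0 andbT eq_sym; apply: contra_neq x0 => x0.
    by apply: dotv_eq0; rewrite -sqr_norm2 x0 expr0n.
  have : f z <= f ((norm2 x)^-1 *: x).
    apply: zmin; rewrite inE /D /= dotvZl dotvZr -sqr_norm2.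
    by field; rewrite gt_eqF.
  rewrite fZ exprVn mulrC ler_pdivlMr ?exprn_gt0 // sqr_norm2.
  by rewrite subr_ge0.
have bil x : dotv (A^T *v z) (A^T *v x) - l * dotv z x = 0.
  apply: (@quadratic_ge0_linear_eq0 (f x - l * dotv x x)) => t.
  have := fmin (z + t *: x).
  rewrite /f mxactD mxactZ !(dotvDl, dotvDr, dotvZl, dotvZr).
  rewrite (dotvC (_ *v x)) (dotvC x z) -/(f z) -/l -/(f x) Dz; lra.
have eig : z *m (A *m A^T) = l *: z.
  apply/rowP => j; have := bil (delta_mx 0 j).
  rewrite -dotv_mxact dotvC -mxactM.
  have dotd (w : 'rV[R]_m) : dotv w (delta_mx 0 j) = w 0 j.
    rewrite /dotv (bigD1 j) //= big1 ?addr0 => [|i ij].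
      by rewrite mxE !eqxx mulr1.
    by rewrite mxE (negbTE ij) andbF mulr0.
  rewrite dotvC !dotd /mxact trmx_mul trmxK mxE => /eqP.
  by rewrite subr_eq0 => /eqP ->; rewrite mxE.
have sl : smallest_singular_value A <= Num.sqrt l.
  apply: ge_inf; first by exists 0 => a [].
  split; first exact: sqrtr_ge0.
  rewrite sqr_sqrtr //; apply/eigenvalueP; exists z => //.
  apply/eqP => z0; move: Dz; rewrite /D /= z0 -(scale0r (0 : 'rV[R]_m)) dotvZl mul0r.
  move=> /esym/eqP.
  by rewrite oner_eq0.
apply: le_trans (ler_wpM2r (norm2_ge0 y) sl) _.
rewrite -(@ler_pXn2r _ 2) ?nnegrE ?mulr_ge0 ?norm2_ge0 ?sqrtr_ge0 //.
rewrite exprMn sqr_sqrtr // !sqr_norm2 -subr_ge0; exact: fmin.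
Qed.

Lemma gram_unitmx n m (J : 'M[R]_(m, n)) : 0 < smallest_singular_value J ->
  J *m J^T \in unitmx.
Proof.
move=> J0; rewrite -row_free_unit; apply: inj_row_free => z zJ.
have : norm2 (J^T *v z) ^+ 2 = 0.
  rewrite sqr_norm2 dotv_mxact trmxK -mxactM.
  by rewrite dotvE /mxact trmx_mul trmxK mulmxA zJ mul0mx mxE.
move/eqP; rewrite sqrf_eq0 => /eqP J0z.
have := smallest_singular_value_le J z; rewrite J0z pmulr_rle0 // => z0.
have {}z0 : norm2 z = 0 by apply/eqP; rewrite eq_le z0 norm2_ge0.
by apply: dotv_eq0; rewrite -sqr_norm2 z0 expr0n.
Qed.

(** With [z] solving [J J^T z = y] one has [p = J^T z] and
    [norm2 p ^+ 2 = dotv z y], while [norm2 z] is at most [norm2 p / sigma]. *)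
Lemma norm2_pinv_le n m (J : 'M[R]_(m, n)) (sigma : R) (y : 'rV[R]_m) :
  0 < sigma -> sigma <= smallest_singular_value J ->
  norm2 (Defs.pinv J *v y) <= norm2 y / sigma.
Proof.
move=> s0 sJ; have J0 := lt_le_trans s0 sJ.
have JU := gram_unitmx J0.
pose z := invmx (J *m J^T) *v y.
have zE : Defs.pinv J *v y = J^T *v z by rewrite /Defs.pinv mxactM.
have yE : y = J *v (J^T *v z).
  by rewrite /z -!mxactM mulmxV // /mxact trmx1 mulmx1.
rewrite zE ler_pdivlMr //; set p := J^T *v z.
have [->|p0] := eqVneq (norm2 p) 0; first by rewrite mul0r norm2_ge0.
have {}p0 : 0 < norm2 p by rewrite lt_neqAle eq_sym p0 norm2_ge0.
have pp : norm2 p ^+ 2 <= norm2 z * norm2 y.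
  rewrite sqr_norm2 {1}/p dotv_mxact trmxK.
  by rewrite -yE dotv_le_norm2.
have sz : sigma * norm2 z <= norm2 p.
  apply: le_trans (smallest_singular_value_le J z).
  by rewrite ler_wpM2r ?norm2_ge0.
rewrite -(ler_pM2l p0).
have := ler_wpM2l (ltW s0) pp; have := ler_wpM2r (norm2_ge0 y) sz; lra.
Qed.

Section Projector.
Variables (n m : nat) (J : 'M[R]_(m, n)).
Hypothesis JU : J *m J^T \in unitmx.
Let Q := 1%:M - Defs.pinv J *m J.

Lemma pinvK : J *m Defs.pinv J = 1%:M.
Proof. by rewrite /Defs.pinv mulmxA mulmxV. Qed.

Lemma proj_pinv : Q *m Defs.pinv J = 0.
Proof. by rewrite mulmxBl mul1mx -mulmxA pinvK mulmx1 subrr. Qed.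

Lemma mul_proj : J *m Q = 0.
Proof. by rewrite mulmxBr mulmx1 mulmxA pinvK mul1mx subrr. Qed.

Lemma proj_idem : Q *m Q = Q.
Proof. by rewrite {2}/Q mulmxBr mulmx1 mulmxA proj_pinv mul0mx subr0. Qed.

Lemma trmx_proj : Q^T = Q.
Proof.
rewrite /Q linearB /= trmx1 /Defs.pinv !trmx_mul trmxK trmx_inv trmx_mul trmxK.
by rewrite mulmxA.
Qed.

Lemma dotv_proj x y : dotv (Q *v x) y = dotv x (Q *v y).
Proof. by rewrite dotv_mxact trmx_proj. Qed.

Lemma norm2_proj_le x : norm2 (Q *v x) <= norm2 x.
Proof.
have [E|p0] := eqVneq (norm2 (Q *v x)) 0; first by rewrite E norm2_ge0.
have {}p0 : 0 < norm2 (Q *v x) by rewrite lt_neqAle eq_sym p0 norm2_ge0.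
rewrite -(ler_pM2l p0) -expr2 sqr_norm2 dotv_proj -mxactM proj_idem dotvC.
exact: dotv_le_norm2.
Qed.

Lemma sqr_norm2_range_kernel x y :
  norm2 (Defs.pinv J *v x + Q *v y) ^+ 2 =
  norm2 (Defs.pinv J *v x) ^+ 2 + norm2 (Q *v y) ^+ 2.
Proof.
have o : dotv (Defs.pinv J *v x) (Q *v y) = 0.
  by rewrite -dotv_proj -mxactM proj_pinv /mxact trmx0 mulmx0
    -(scale0r (0 : 'rV[R]_n)) dotvZl mul0r.
by rewrite !sqr_norm2 dotvDl !dotvDr o (dotvC (Q *v y)) o addr0 add0r.
Qed.

End Projector.

End Euclidean.

(** * The descent inequality *)

Section Descent.
Context {R : realType} {n : nat}.
Implicit Types (f : 'rV[R]_n -> R) (x y z v : 'rV[R]_n).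

Lemma derive_grad f x v : differentiable f x -> 'D_v f x = dotv (grad f x) v.
Proof.
move=> fx; rewrite deriveE // {1}(row_sum_delta v) linear_sum /dotv.
by apply: eq_bigr => i _; rewrite linearZ /= mxE deriveE // mulrC.
Qed.

Lemma is_derive_line f y v t : differentiable f (y + t *: v) ->
  is_derive t 1 (fun t => f (y + t *: v)) (dotv (grad f (y + t *: v)) v).
Proof.
move=> fx; set x := y + t *: v in fx *.
have E : (fun h : R => h^-1 *: (f (y + (h *: 1 + t) *: v) - f (y + t *: v))) =
         (fun h : R => h^-1 *: (f (h *: v + x) - f x)).
  apply/funext => h; congr (_ *: (f _ - _)).
  by rewrite /x scalerDl [h *: 1]mulr1 addrCA addrC.
rewrite -derive_grad //; apply: DeriveDef.
  by have := @diff_derivable _ _ _ f x v fx; rewrite /derivable /= -E.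
by rewrite /derive /= E.
Qed.

Lemma convex_segment (X : set 'rV[R]_n) y z t :
  convex_set (X : set (convex_lmodType 'rV[R]_n)) -> X y -> X z ->
  0 <= t <= 1 -> X (y + t *: (z - y)).
Proof.
move=> Xc Xy Xz t01.
have := Xc z y (Itv01 (proj1 (andP t01)) (proj2 (andP t01))).
rewrite !inE => /(_ Xz Xy); congr X.
rewrite /conv /= scalerBr /unstable.onem scalerBl scale1r.
by rewrite addrC addrAC addrA.
Qed.

(** The function that subtracts the claimed upper bound from [f] on the segment
    from [y] to [z] has a nonpositive derivative. *)
Lemma lipschitz_gradient_le f (X : set 'rV[R]_n) (L : R) :
  convex_set (X : set (convex_lmodType 'rV[R]_n)) ->
  (forall y, X y -> differentiable f y) ->
  (forall y z, X y -> X z -> norm2 (grad f y - grad f z) <= L * norm2 (y - z)) ->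
  forall y z, X y -> X z ->
    f z <= f y + dotv (grad f y) (z - y) + L / 2 * norm2 (z - y) ^+ 2.
Proof.
move=> Xc fd gl y z Xy Xz.
set v := z - y; set a := dotv _ v; set N := norm2 v ^+ 2.
pose q : R -> R := a *: (@id R) + (L / 2 * N) *: ((@id R) ^+ 2).
have dq (t : R) : is_derive t 1 q (a + L * N * t).
  apply: is_derive_eq.
  rewrite /GRing.scale /= !mulr1 expr1 /= -mulr_natl; by field.
pose g := (fun t0 : R => f (y + t0 *: v)) - q.
have seg (t : R) : 0 <= t <= 1 -> X (y + t *: v) by exact: convex_segment.
have dg (t : R) : 0 <= t <= 1 ->
    is_derive t 1 g (dotv (grad f (y + t *: v)) v - (a + L * N * t)).
  move=> t01; have D1 := is_derive_line (fd _ (seg _ t01)).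
  exact: is_deriveB.
have g10 : g 1 <= g 0.
  apply: (@ler0_derive1_nincr _ g 0 1) => //; rewrite ?lexx //.
  - move=> t; rewrite in_itv /= => /andP[t0 t1].
    by apply: ex_derive; apply: dg; rewrite !ltW.
  - move=> t; rewrite in_itv /= => /andP[t0 t1].
    have t01 : 0 <= t <= 1 by rewrite !ltW.
    rewrite derive1E; have := dg t t01 => D; rewrite derive_val.
    have : dotv (grad f (y + t *: v) - grad f y) v <= L * norm2 (t *: v) * norm2 v.
      apply: le_trans (dotv_le_norm2 _ _) _; rewrite ler_wpM2r ?norm2_ge0 //.
      by apply: le_trans (gl _ _ (seg _ t01) Xy) _; rewrite addrAC subrr add0r.
    rewrite norm2Z (ger0_norm (ltW t0)) -scaleN1r dotvDl dotvZl -/a /N expr2; lra.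
  - apply: derivable_within_continuous => t; rewrite in_itv /= => t01.
    by apply: ex_derive; exact: dg.
move: g10; rewrite /g /q !fctE /= !scale1r !scale0r addr0 /GRing.scale /=.
rewrite expr0n /= expr1n /v (addrC y) subrK; lra.
Qed.
End Descent.

(** * Measurability of random vectors and matrices *)

Section MeasurableVectors.
Context {R : realType} {dT : measure_display} {T : measurableType dT}.
Implicit Types n m p : nat.

(** Every open set is the union of the countably many boxes with rational
    centre and radius that it contains. *)
Lemma measurable_preimage_open n (x : T -> 'rV[R]_n) (O : set 'rV[R]_n) :
  (forall i, measurable_fun setT (fun w => x w 0 i)) -> open O ->
  measurable (x @^-1` O).
Proof.
move=> mx oO.
pose box (qr : 'rV[rat]_n * rat) : set 'rV[R]_n :=
  [set y : 'rV[R]_n | forall i, ball (ratr (qr.1 0 i) : R) (ratr qr.2) (y 0 i)].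
pose F (qr : 'rV[rat]_n * rat) :=
  if `[< box qr `<=` O >] then x @^-1` box qr else set0.
have -> : x @^-1` O = \bigcup_qr F qr.
  apply/seteqP; split => [w Ow|w [qr _]]; last first.
    by rewrite /F; case: asboolP => // sub /sub.
  have := open_nbhs_nbhs (conj oO Ow) => /nbhs_ballP[e /= e0 eO].
  have [r] := @rat_in_itvoo R 0 (e / 2) (divr_gt0 e0 (ltr0n _ 2)).
  rewrite in_itv /= => /andP[r0 re].
  have /choice[q qP] i : exists q, ball (ratr q : R) (ratr r) (x w 0 i).
    have [q] := @rat_in_itvoo R (x w 0 i - ratr r) (x w 0 i + ratr r) ltac:(lra).
    rewrite in_itv /= => /andP[q1 q2]; exists q.
    by rewrite /ball /= ltr_distl; lra.
  exists (\row_i q i, r) => //; rewrite /F ifT; last first.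
    apply/asboolP => y yb; apply: eO; split => // i j.
    have := yb j; rewrite ord1 /= mxE; have := qP j.
    rewrite /ball /= !ltr_distl; lra.
  by move=> i /=; rewrite mxE; exact: qP.
apply: countable_bigcupT_measurable => // qr; rewrite /F; case: ifP => // _.
rewrite (_ : _ @^-1` _ = \bigcap_i
    ((fun w => x w 0 i) @^-1` ball (ratr (qr.1 0 i) : R) (ratr qr.2))).
  apply: fin_bigcap_measurable; first exact: finite_finset.
  move=> i _; rewrite -[X in measurable X]setTI; apply: mx => //.
  exact: measurable_ball.
by apply/seteqP; split => w /= H i; [move=> _|]; apply: H.
Qed.

Lemma measurable_continuous_comp n (x : T -> 'rV[R]_n) (X : set 'rV[R]_n)
    (g : 'rV[R]_n -> R) :
  (forall i, measurable_fun setT (fun w => x w 0 i)) -> open X ->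
  (forall w, X (x w)) -> (forall y, X y -> {for y, continuous g}) ->
  measurable_fun setT (fun w => g (x w)).
Proof.
move=> mx oX Xx gc.
apply: (measurability _ (RGenOpens.measurableE R)).
move=> _ [_ [a [b ->]] <-]; rewrite setTI.
rewrite (_ : _ @^-1` _ = x @^-1` (X `&` g @^-1` `]a, b[%classic)).
  apply: measurable_preimage_open => //.
  rewrite openE => y [Xy gy]; apply: filterI; first exact: open_nbhs_nbhs.
  by apply: gc => //; apply: open_nbhs_nbhs; split => //; exact: interval_open.
by apply/seteqP; split => w /=; [move=> ?; split|case].
Qed.

(** The power function is measurable everywhere on the line, and
    [(g ^+ 2) ^ (-1)] has the right value also where [g] vanishes. *)
Lemma measurable_inv (g : T -> R) :
  measurable_fun setT g -> measurable_fun setT (fun w => (g w)^-1).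
Proof.
move=> mg; rewrite (_ : (fun w => _) = fun w => g w * (g w ^+ 2) `^ (-1)).
  apply: measurable_funM => //.
  apply: (measurableT_comp (@measurable_powR R (-1))).
  exact: measurable_funX.
apply/funext => w; rewrite powR_inv1 ?sqr_ge0 //.
have [->|g0] := eqVneq (g w) 0; first by rewrite invr0 mul0r.
by field.
Qed.

Lemma measurable_sqrt (g : T -> R) :
  measurable_fun setT g -> measurable_fun setT (fun w => Num.sqrt (g w)).
Proof.
move=> mg; apply: (measurableT_comp _ mg).
by apply: continuous_measurable_fun; exact: sqrt_continuous.
Qed.

Definition measurable_mx m n (A : T -> 'M[R]_(m, n)) :=
  forall i j, measurable_fun setT (fun w => A w i j).

Lemma measurable_mulmx m n p (A : T -> 'M[R]_(m, n)) (B : T -> 'M[R]_(n, p)) :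
  measurable_mx A -> measurable_mx B -> measurable_mx (fun w => A w *m B w).
Proof.
move=> mA mB i j; under eq_fun do rewrite mxE.
by apply: measurable_sum => k; exact: measurable_funM.
Qed.

Lemma measurable_addmx m n (A B : T -> 'M[R]_(m, n)) :
  measurable_mx A -> measurable_mx B -> measurable_mx (fun w => A w + B w).
Proof.
by move=> mA mB i j; under eq_fun do rewrite mxE; exact: measurable_funD.
Qed.

Lemma measurable_scalemx m n (a : T -> R) (A : T -> 'M[R]_(m, n)) :
  measurable_fun setT a -> measurable_mx A -> measurable_mx (fun w => a w *: A w).
Proof.
by move=> ma mA i j; under eq_fun do rewrite mxE; exact: measurable_funM.
Qed.

Lemma measurable_trmx m n (A : T -> 'M[R]_(m, n)) :
  measurable_mx A -> measurable_mx (fun w => (A w)^T).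
Proof. by move=> mA i j; under eq_fun do rewrite mxE; exact: mA. Qed.

Lemma measurable_det n (A : T -> 'M[R]_n) :
  measurable_mx A -> measurable_fun setT (fun w => \det (A w)).
Proof.
move=> mA; rewrite /determinant.
apply: measurable_sum => s; apply: measurable_funM; first exact: measurable_cst.
by apply: measurable_prod => i _; exact: mA.
Qed.

Lemma measurable_invmx n (A : T -> 'M[R]_n) :
  (forall w, A w \in unitmx) -> measurable_mx A ->
  measurable_mx (fun w => invmx (A w)).
Proof.
move=> uA mA i j; under eq_fun do rewrite /invmx uA mxE mxE /cofactor.
apply: measurable_funM; first exact/measurable_inv/measurable_det.
apply: measurable_funM; first exact: measurable_cst.
apply: measurable_det => k l; under eq_fun do rewrite !mxE.
exact: mA.
Qed.

Lemma measurable_mxact m n (A : T -> 'M[R]_(m, n)) (x : T -> 'rV[R]_n) :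
  measurable_mx A -> measurable_mx x -> measurable_mx (fun w => A w *v x w).
Proof.
by move=> mA mx; apply: measurable_mulmx => //; exact: measurable_trmx.
Qed.

Lemma measurable_pinv m n (J : T -> 'M[R]_(m, n)) :
  (forall w, J w *m (J w)^T \in unitmx) -> measurable_mx J ->
  measurable_mx (fun w => Defs.pinv (J w)).
Proof.
move=> uJ mJ; rewrite /Defs.pinv.
apply: measurable_mulmx; first exact: measurable_trmx.
apply: measurable_invmx => //.
by apply: measurable_mulmx => //; exact: measurable_trmx.
Qed.

End MeasurableVectors.

(** * Integration against a conditional expectation *)

Section ConditionalExpectation.
Context {R : realType} {dO : measure_display} {Omega : measurableType dO}.
Variable P : probability Omega R.

Lemma integrable_boundedM (h Z : Omega -> R) (C : R) :
  measurable_fun setT h -> (forall w, `|h w| <= C) ->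
  P.-integrable setT (EFin \o Z) ->
  P.-integrable setT (EFin \o (fun w => h w * Z w)).
Proof.
move=> mh hC iZ.
have H : P.-integrable setT ((EFin \o h) \* (EFin \o Z))%E.
  apply: integrableMr => //; exists C; split; first exact: num_real.
  by move=> M CM w _; apply: le_trans (hC w) (ltW CM).
by move: H; congr (_.-integrable _ _); apply/funext => w /=; rewrite EFinM.
Qed.

Lemma integrable_bounded (h : Omega -> R) (C : R) :
  measurable_fun setT h -> (forall w, `|h w| <= C) ->
  P.-integrable setT (EFin \o h).
Proof.
move=> mh hC; apply: measurable_bounded_integrable => //.
  by apply: le_lt_trans (probability_le1 P measurableT) _; rewrite ltry.
exists C; split; first exact: num_real.
by move=> M CM w _; apply: le_trans (hC w) (ltW CM).
Qed.

(** [N * h] is within one of its integer part, a finite sum of indicators of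
    sets of [G]; as [N] grows the integral of [h * Z] is squeezed to zero. *)
Lemma Rintegral_mul_ge0_eq0 (G : set (set Omega)) (h Z : Omega -> R) (C : R) :
  (forall A, G A -> measurable A) ->
  (forall B, measurable B -> G (h @^-1` B)) -> (forall w, 0 <= h w <= C) ->
  P.-integrable setT (EFin \o Z) ->
  (forall A, G A -> \int[P]_(w in A) Z w = 0) ->
  \int[P]_w (h w * Z w) = 0.
Proof.
move=> mG Gh hC iZ Z0.
have mh : measurable_fun setT h.
  by move=> _ B mB; rewrite setTI; apply/mG/Gh.
have iabs : P.-integrable setT (EFin \o (fun w => `|Z w|)) by exact: integrable_norm.
have h_abs w : `|h w| <= C.
  by have /andP[h0 h1] := hC w; rewrite ger0_norm.
have ihZ := integrable_boundedM mh h_abs iZ.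
have key N : `|N%:R * \int[P]_w (h w * Z w)| <= \int[P]_w `|Z w|.
  pose B := (Num.truncn (N%:R * C)).
  pose A q := [set w | q.+1%:R <= N%:R * h w].
  have GA q : G (A q).
    have : measurable [set y : R | q.+1%:R <= N%:R * y].
      rewrite [X in measurable X](_ : _ = ( *%R N%:R) @^-1` `[q.+1%:R, +oo[).
        rewrite -[X in measurable X]setTI.
        by apply: mulrl_measurable => //; exact: measurable_itv.
      by apply/seteqP; split => y /=; rewrite in_itv /= andbT.
    by move=> /Gh.
  have mA q : measurable (A q) by exact/mG/GA.
  pose S b w : R := \sum_(q < b) \1_(A q) w.
  have mS b : measurable_fun setT (S b).
    by apply: measurable_sum => q; exact: measurable_indic.
  have S_b b w : `|S b w| <= b%:R.
    rewrite ger0_norm; last by apply: sumr_ge0 => q _; rewrite indicE ler0n.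
    rewrite -[b in leRHS]card_ord -sum1_card natr_sum; apply: ler_sum => q _.
    by rewrite indicE; case: (_ \in _).
  have iSZ b := integrable_boundedM (mS b) (S_b b) iZ.
  have SZ b : \int[P]_w (S b w * Z w) = 0.
    elim: b => [|b IH].
      under eq_Rintegral do rewrite /S big_ord0 mul0r.
      by rewrite Rintegral_cst ?mul0r.
    have mI : measurable_fun setT (\1_(A b) : Omega -> R) by exact: measurable_indic.
    have I1 w : `|\1_(A b) w : R| <= 1.
      by rewrite indicE; case: (_ \in _); rewrite ?normr1 ?normr0.
    under eq_Rintegral do rewrite /S big_ord_recr /= mulrDl.
    rewrite RintegralD //; [|exact: iSZ|exact: (integrable_boundedM mI I1 iZ)].
    rewrite IH add0r -[RHS](Z0 _ (GA b)) [RHS]Rintegral_mkcond patch_indic.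
    by apply: eq_Rintegral => w _ /=; rewrite mulrC.
  have SE w : S B w = (Num.truncn (N%:R * h w))%:R.
    have /andP[h0 h1] := hC w.
    have tB : (Num.truncn (N%:R * h w) <= B)%N.
      by apply: le_truncn; rewrite ler_wpM2l.
    rewrite /S (eq_bigr (fun q : 'I_B => if (q < Num.truncn (N%:R * h w))%N then 1 else 0)).
      by rewrite -big_mkcond /= (big_ord_narrow tB) sumr_const card_ord.
    move=> q _; rewrite indicE truncn_gt_nat.
    by case: ifP => H; [rewrite mem_set|rewrite memNset // /A /= H].
  have -> : N%:R * \int[P]_w (h w * Z w) = \int[P]_w (N%:R * (h w * Z w) - S B w * Z w).
    rewrite RintegralB // ?RintegralZl // ?SZ ?subr0 //.
    exact: (integrableZl measurableT N%:R ihZ).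
  have iD : P.-integrable setT (EFin \o (fun w => N%:R * (h w * Z w) - S B w * Z w)).
    have i1 : P.-integrable setT (EFin \o (fun w => N%:R * (h w * Z w))).
      exact: (integrableZl measurableT N%:R ihZ).
    exact: (integrableB measurableT i1 (iSZ B)).
  apply: le_trans (le_normr_Rintegral measurableT iD) _.
  apply: le_Rintegral => //; first exact: integrable_norm.
  move=> w _; rewrite mulrA -mulrBl normrM ler_piMl // SE.
  have /andP[h0 _] := hC w.
  have /truncn_itv/andP[t1 t2] : 0 <= N%:R * h w by rewrite mulr_ge0.
  by rewrite ger0_norm ?subr_ge0 // lerBlDl natr1 ltW.
apply/eqP; rewrite -normr_eq0 eq_le normr_ge0 andbT leNgt; apply/negP => I0.
set I := `| _ | in I0; set E := Rintegral P setT (fun w => `|Z w|) in key.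
have := key (Num.truncn (E / I)).+1; rewrite normrM normr_nat -/I.
rewrite -ler_pdivlMr // leNgt => /negP; apply.
have E0 : 0 <= E by apply: Rintegral_ge0 => w _.
by have /truncn_itv/andP[] : 0 <= E / I by rewrite divr_ge0 // ltW.
Qed.

(** Shifting [h] by a constant is harmless, as the integral of [Z] is zero. *)
Lemma Rintegral_mul_bounded_eq0 (G : set (set Omega)) (h Z : Omega -> R) (C : R) :
  (forall A, G A -> measurable A) ->
  (forall B, measurable B -> G (h @^-1` B)) -> (forall w, `|h w| <= C) ->
  P.-integrable setT (EFin \o Z) ->
  (forall A, G A -> \int[P]_(w in A) Z w = 0) ->
  \int[P]_w (h w * Z w) = 0.
Proof.
move=> mG Gh hC iZ Z0.
have mh : measurable_fun setT h by move=> _ B mB; rewrite setTI; apply/mG/Gh.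
have H : \int[P]_w ((h w + C) * Z w) = 0.
  apply: (@Rintegral_mul_ge0_eq0 G (fun w => h w + C) Z (C + C)) => //.
    move=> B mB; apply: (Gh ((fun y => y + C) @^-1` B)).
    have mC : measurable_fun setT (fun y : R => y + C).
      exact: (@measurable_funD _ _ R setT id (cst C)).
    by rewrite -[X in measurable X]setTI; exact: mC.
  by move=> w; have := hC w; rewrite ler_norml; lra.
move: H; under eq_Rintegral do rewrite mulrDl.
rewrite RintegralD //; last 2 first.
- exact: integrable_boundedM hC iZ.
- exact: (integrableZl measurableT C iZ).
rewrite RintegralZl // (Z0 setT) ?mulr0 ?addr0 //.
by rewrite -(preimage_setT h); apply: Gh.
Qed.

(** The defining property of the conditional expectation, extended from
    indicators to bounded [G]-measurable weights. *)
Lemma cond_exp_orthogonal (G : set (set Omega)) (X Y h : Omega -> R) (C : R) :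
  is_cond_exp P G X Y -> (forall A, G A -> measurable A) ->
  (forall B, measurable B -> G (h @^-1` B)) -> (forall w, `|h w| <= C) ->
  P.-integrable setT (EFin \o (fun w => h w * (X w - Y w))) /\
  \int[P]_w (h w * (X w - Y w)) = 0.
Proof.
move=> [iX iY mY XY] mG Gh hC.
have mh : measurable_fun setT h by move=> _ B mB; rewrite setTI; apply/mG/Gh.
have iZ : P.-integrable setT (EFin \o (fun w => X w - Y w)).
  exact: (integrableB measurableT iX iY).
split; first exact: integrable_boundedM hC iZ.
apply: (Rintegral_mul_bounded_eq0 mG Gh hC iZ) => A GA.
rewrite RintegralB; [|exact: mG|
  exact: (integrableS measurableT (mG _ GA) (@subsetT _ _) iX)|
  exact: (integrableS measurableT (mG _ GA) (@subsetT _ _) iY)].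
by rewrite /Rintegral XY // subrr.
Qed.

End ConditionalExpectation.

(** * Merit decrease along one run *)

Section Run.
Context {R : realType} {n m : nat}.
Variables (f : 'rV[R]_n -> R) (c : 'rV[R]_n -> 'rV[R]_m).
Variables (x1 : 'rV[R]_n) (rho h : nat -> R) (beta1 beta2 alpha eps : R).
Variables (g x v u r s d : nat -> 'rV[R]_n).
Hypothesis run : adam_sqp_run c x1 rho h beta1 beta2 alpha eps g x v u r s d.
Hypotheses (b1_ge0 : 0 <= beta1) (b12 : beta1 < beta2) (b2_lt1 : beta2 < 1).
Hypotheses (alpha01 : 0 < alpha <= 1) (eps_gt0 : 0 < eps).
Variables (X : set 'rV[R]_n) (finf kappa_c kappa_f L_f sigma : R).
Hypothesis Xconvex : convex_set (X : set (convex_lmodType 'rV[R]_n)).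
Hypothesis xX : forall k, X (x k.+1).
Hypotheses (L_f_gt0 : 0 < L_f) (sigma_gt0 : 0 < sigma) (kf_gt0 : 0 < kappa_f).
Hypothesis f_diff : forall y, X y -> differentiable f y.
Hypothesis f_lb : forall y, X y -> finf <= f y.
Hypothesis c_ub : forall y, X y -> norm2 (c y) <= kappa_c.
Hypothesis gradf_ub : forall y, X y -> norm2 (grad f y) <= kappa_f.
Hypothesis gradf_lip : forall y z, X y -> X z ->
  norm2 (grad f y - grad f z) <= L_f * norm2 (y - z).
Hypothesis J_sigma : forall y, X y -> sigma <= smallest_singular_value (jac c y).
Variables (S rho_min rho_max h_min h_max : R).
Hypotheses (S_gt0 : 0 < S) (h_min_gt0 : 0 < h_min).
Hypotheses (rho_min_gt0 : 0 < rho_min) (rho_max1 : rho_max <= 1).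
Hypothesis rho_bnd : forall k, rho_min <= rho k.+1 <= rho_max.
Hypothesis h_bnd : forall k, h_min <= h k.+1 <= h_max.
Hypothesis u_bnd : forall k i, (u k.+1 0 i) ^+ 2 <= (S / h_min) ^+ 2 - eps.
Variables (L_J L_Pf : R).
Hypotheses (L_J_gt0 : 0 < L_J) (L_Pf_gt0 : 0 < L_Pf).
Hypothesis c_descent : forall y z, X y -> X z ->
  norm1 (c z) <=
    norm1 (c y + jac c y *v (z - y)) + 2^-1 * L_J * norm2 (z - y) ^+ 2.
Hypothesis Pgradf_lip : forall y z, X y -> X z ->
  norm2 (Pmx c y *v grad f y - Pmx c z *v grad f z) <= L_Pf * norm2 (y - z).

Let tau := sigma * rho_min / (sigma * rho_min + kappa_f * rho_max).
Let etab := (1 - beta1) / Num.sqrt (1 - beta2).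
Let V := (rho_max * kappa_c / sigma) ^+ 2.
Let G t := Pmx c (x t.+1) *v grad f (x t.+1).
Let q t := \sum_(i < n) r t.+1 0 i ^+ 2 / (s t.+1 0 i + eps).

Let JU t : jac c (x t.+1) *m (jac c (x t.+1))^T \in unitmx.
Proof. by apply: gram_unitmx; apply: lt_le_trans (J_sigma (xX t)). Qed.

Let rho_gt0 t : 0 < rho t.+1.
Proof. by have /andP[/(lt_le_trans rho_min_gt0)] := rho_bnd t. Qed.
Let rho_max_gt0 : 0 < rho_max.
Proof. by have /andP[_] := rho_bnd 0; apply: lt_le_trans. Qed.
Let b1' : 0 < 1 - beta1.
Proof. by rewrite subr_gt0; exact: lt_trans b12 b2_lt1. Qed.
Let b2' : 0 < 1 - beta2.
Proof. by rewrite subr_gt0. Qed.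

Lemma run_first_moment t i : r t.+1 0 i = beta1 * r t 0 i + u t.+1 0 i.
Proof. by rewrite (run_r run) // !mxE. Qed.

Lemma run_second_moment t i : s t.+1 0 i = beta2 * s t 0 i + u t.+1 0 i ^+ 2.
Proof. by rewrite (run_s run) // !mxE expr2. Qed.

Let r00 i : r 0%N 0 i = 0. Proof. by rewrite (run_r0 run) mxE. Qed.
Let s00 i : s 0%N 0 i = 0. Proof. by rewrite (run_s0 run) mxE. Qed.

Let s_ge0 k i : 0 <= s k 0 i.
Proof.
exact: (@second_moment_ge0 _ _ _ _ (fun k => s k 0 i) b1_ge0 b12 (s00 i)
  (run_second_moment^~ i)).
Qed.

Let eta_ge0 t : 0 <= eta beta1 beta2 t.
Proof. by rewrite /eta divr_ge0 ?mulr_ge0 ?sqrtr_ge0 // ltW. Qed.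

Let eta_le t : eta beta1 beta2 t <= etab.
Proof.
rewrite /eta /etab ler_wpM2r ?invr_ge0 ?sqrtr_ge0 // ler_piMr ?(ltW b1') //.
rewrite -[leRHS]sqrtr1 ler_sqrt // gerBl exprn_ge0 //.
by apply/ltW; exact: le_lt_trans b1_ge0 b12.
Qed.

Lemma scaled_entry t i :
  (scaling eps (s t) *v r t) 0 i = r t 0 i / Num.sqrt (s t 0 i + eps).
Proof.
rewrite /mxact /scaling tr_diag_mx mxE (bigD1 i) //= big1 ?addr0 => [|j ji].
  by rewrite !mxE eqxx mulr1n.
by rewrite !mxE (negbTE ji) mulr0n mulr0.
Qed.

Lemma sqr_norm2_normal t : norm2 (v t.+1) ^+ 2 <= V.
Proof.
rewrite (run_v run) // norm2Z normrN (ger0_norm (ltW (rho_gt0 t))).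
have /andP[_ rle] := rho_bnd t.
have kc_ge0 : 0 <= kappa_c by apply: le_trans (norm2_ge0 _) (c_ub (xX t)).
have bound_ge0 : 0 <= rho_max * kappa_c / sigma.
  by rewrite divr_ge0 ?mulr_ge0 // ltW.
have lhs_ge0 := mulr_ge0 (ltW (rho_gt0 t)) 
  (norm2_ge0 (Defs.pinv (jac c (x t.+1)) *v c (x t.+1))).
rewrite ler_sqr ?nnegrE //.
rewrite -mulrA; apply: ler_pM; rewrite ?(ltW (rho_gt0 t)) ?norm2_ge0 //.
apply: le_trans (norm2_pinv_le _ sigma_gt0 (J_sigma (xX t))) _.
by rewrite ler_pM2r ?invr_gt0 //; exact: c_ub.
Qed.

(** The two parts of the step are orthogonal, and the projector does not increase
    the Euclidean norm. *)
Lemma sqr_norm2_step t : norm2 (d t.+1) ^+ 2 <= V + etab ^+ 2 * q t.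
Proof.
rewrite (run_d run) // mxactM -mxactZ.
have vE := run_v run (ltn0Sn t).
rewrite {1}vE -[- rho _ *: _]mxactZ /Pmx sqr_norm2_range_kernel // mxactZ
  -vE -/(Pmx c (x t.+1)).
apply: lerD; first exact: sqr_norm2_normal.
apply: (@le_trans _ _ (norm2 (eta beta1 beta2 t.+1 *:
    (scaling eps (s t.+1) *v r t.+1)) ^+ 2)).
  by rewrite ler_sqr ?nnegrE ?norm2_ge0 // /Pmx norm2_proj_le.
rewrite norm2Z exprMn (ger0_norm (eta_ge0 _)); apply: ler_pM; rewrite ?sqr_ge0 //.
  by rewrite ler_sqr ?nnegrE ?(le_trans (eta_ge0 0) (eta_le 0)).
rewrite sqr_norm2 /dotv; apply: ler_sum => i _.
rewrite -expr2 scaled_entry expr_div_n sqr_sqrtr ?addr_ge0 //.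
exact: ltW.
Qed.

Let tau_gt0 : 0 < tau.
Proof. by rewrite /tau divr_gt0 ?addr_gt0 ?mulr_gt0. Qed.

Let tauE : tau * (kappa_f * (rho_max / sigma)) = rho_min * (1 - tau).
Proof.
rewrite /tau; field; rewrite !gt_eqF ?addr_gt0 ?mulr_gt0 //.
Qed.

(** The Lipschitz bounds on [grad f] and on the linearization of [c] meet in the
    quadratic term; the linear growth of [tau * f] along the normal step is paid
    by the decrease of [norm1 c], through the identity defining [tau]. *)
Lemma merit_decrease t :
  merit f c (x t.+2) tau <= merit f c (x t.+1) tau
    - alpha * tau * rho_min * norm1 (c (x t.+1))
    + alpha * tau * (eta beta1 beta2 t.+1 *
        \sum_(i < n) G t 0 i * r t.+1 0 i / Num.sqrt (s t.+1 0 i + eps))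
    + (tau * L_f + L_J) / 2 * alpha ^+ 2 * (V + etab ^+ 2 * q t).
Proof.
have /andP[a0 a1] := alpha01.
pose y := x t.+1; pose z := x t.+2; pose D := d t.+1.
have zy : z - y = alpha *: D by rewrite /z (run_x run) // addrAC subrr add0r.
have Dle := sqr_norm2_step t; rewrite -/D in Dle.
pose T := scaling eps (s t.+1) *v r t.+1.
have DE : D = v t.+1 + eta beta1 beta2 t.+1 *: (Pmx c y *v T).
  by rewrite /D (run_d run) // mxactM.
have f1 := lipschitz_gradient_le Xconvex f_diff gradf_lip (xX t) (xX t.+1).
have c1 := c_descent (xX t) (xX t.+1).
rewrite -/y -/z zy norm2Z exprMn real_normK ?num_real // in f1 c1.
pose N := norm2 D ^+ 2; rewrite -/N in f1 c1 Dle.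
have JD : jac c y *v D = - rho t.+1 *: c y.
  rewrite DE mxactD mxactZ -[jac c y *v (Pmx c y *v T)]mxactM mul_proj ?JU //.
  rewrite {2}/mxact trmx0 mulmx0 scaler0 addr0 (run_v run) // mxactZ -mxactM.
  by rewrite pinvK ?JU // /mxact trmx1 mulmx1.
have c2 : norm1 (c y + jac c y *v (alpha *: D)) = (1 - alpha * rho t.+1) * norm1 (c y).
  rewrite mxactZ JD scalerA /norm1 mulr_sumr; apply: eq_bigr => i _.
  rewrite !mxE [X in Num.norm X = _](_ : _ = (1 - alpha * rho t.+1) * c y 0 i); last by ring.
  rewrite normrM ger0_norm // subr_ge0 mulr_ile1 ?(ltW a0) ?(ltW (rho_gt0 t)) //.
  by have /andP[_ /le_trans] := rho_bnd t; apply.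
have gD : dotv (grad f y) D <= kappa_f * (rho_max / sigma) * norm1 (c y) +
   eta beta1 beta2 t.+1 *
        \sum_(i < n) G t 0 i * r t.+1 0 i / Num.sqrt (s t.+1 0 i + eps).
  rewrite DE dotvDr dotvZr; apply: lerD.
    apply: le_trans (dotv_le_norm2 _ _) _.
    rewrite -mulrA; apply: ler_pM; rewrite ?norm2_ge0 ?gradf_ub //; first exact: xX.
    rewrite (run_v run) // norm2Z normrN (ger0_norm (ltW (rho_gt0 t))) -mulrA.
    have /andP[_ rle] := rho_bnd t.
    apply: ler_pM; rewrite ?norm2_ge0 ?(ltW (rho_gt0 t)) //.
    apply: le_trans (norm2_pinv_le _ sigma_gt0 (J_sigma (xX t))) _.
    by rewrite mulrC ler_pM2l ?invr_gt0 // norm2_le_norm1.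
  rewrite ler_wpM2l // -dotv_proj ?JU // /dotv; apply: ler_sum => i _.
  by rewrite scaled_entry mulrA.
rewrite /merit -/y -/z.
rewrite dotvZr in f1.
have rmin : rho_min <= rho t.+1 by have /andP[] := rho_bnd t.
have cge : 0 <= norm1 (c y) by apply: sumr_ge0.
have gD' := ler_wpM2l (ltW (mulr_gt0 a0 tau_gt0)) gD.
have f1' := ler_wpM2l (ltW tau_gt0) f1.
have r1 := ler_wpM2r cge (ler_wpM2l (ltW a0) rmin).
have N1 : (tau * L_f + L_J) / 2 * alpha ^+ 2 * N <=
   (tau * L_f + L_J) / 2 * alpha ^+ 2 * (V + etab ^+ 2 * q t).
  apply: ler_wpM2l => //; rewrite mulr_ge0 ?sqr_ge0 // divr_ge0 // addr_ge0 //.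
    by rewrite mulr_ge0 // ltW.
  exact: ltW.
have tE : alpha * norm1 (c y) * (tau * (kappa_f * (rho_max / sigma))) =
    alpha * norm1 (c y) * (rho_min * (1 - tau)) by rewrite tauE.
rewrite c2 in c1.
set A := \sum_(i < n) _ in gD' *.
move: gD' f1' r1 N1 tE c1; set C := norm1 (c y); set Cz := norm1 (c z).
set E := dotv _ _; set Fy := f y; set Fz := f z; set et := eta _ _ _.
lra.
Qed.

Definition noise_weight t k i : R :=
  eta beta1 beta2 t.+1 * beta1 ^+ k * (G (t - k) 0 i
    / Num.sqrt (surrogate beta2 eps (fun j => s j 0 i) S h_min t k + eps)).

(** The only part of the upper bound that depends on the outcome. *)
Definition noise K : R :=
  \sum_(i < n) \sum_(t < K) \sum_(k < t.+1)
    noise_weight t k i * (u (t - k).+1 0 i + G (t - k) 0 i / h (t - k).+1).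

Let Lam K := ln (1 + S ^+ 2 / (h_min ^+ 2 * (1 - beta2) * eps)) - K%:R * ln beta2.
Let q1' : 0 < 1 - beta1 / beta2.
Proof. by rewrite subr_gt0 ltr_pdivrMr ?mul1r // (le_lt_trans b1_ge0). Qed.

Let b2_gt0 : 0 < beta2.
Proof. exact: le_lt_trans b1_ge0 b12. Qed.

Lemma sum_normalized_entry_le K i :
  \sum_(t < K) u t.+1 0 i ^+ 2 / (s t.+1 0 i + eps) <= Lam K.
Proof.
have H := sum_normalized_sqr_le b1_ge0 b12 b2_lt1 eps_gt0 (s00 i)
  (run_second_moment^~ i) K.
apply: le_trans H _; rewrite /Lam lerD2r.
have sp : 0 <= s K 0 i / eps by rewrite divr_ge0 // ltW.
have dp : 0 < h_min ^+ 2 * (1 - beta2) * eps by rewrite !mulr_gt0 ?exprn_gt0.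
have Sp : 0 <= S ^+ 2 / (h_min ^+ 2 * (1 - beta2) * eps).
  by rewrite divr_ge0 ?sqr_ge0 // ltW.
rewrite ler_ln ?posrE; [|lra|lra].
rewrite lerD2l invfM mulrA ler_pM2r ?invr_gt0 //.
apply: le_trans (second_moment_le b1_ge0 b12 b2_lt1 (s00 i)
  (run_second_moment^~ i) h_min_gt0 (u_bnd^~ i) K) _.
rewrite invfM [leRHS]mulrA -expr_div_n; apply: ler_pM.
- exact: le_trans (sqr_ge0 _) (u_bnd 0 i).
- by rewrite divr_ge0 ?(ltW b2') // subr_ge0 exprn_ile1 // ltW.
- by rewrite gerBl ltW.
- by rewrite ler_piMl ?invr_ge0 ?(ltW b2') // gerBl exprn_ge0 // ltW.
Qed.

Let Lam_ge0 K : 0 <= Lam K.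
Proof.
rewrite /Lam addr_ge0 //.
  by rewrite ln_ge0 // lerDl divr_ge0 ?sqr_ge0 // !mulr_ge0 ?sqr_ge0 // ltW.
by rewrite -mulrN mulr_ge0 // oppr_ge0 ln_le0 // ltW.
Qed.

Lemma sum_q_le K :
  \sum_(t < K) q t <= n%:R * Lam K / ((1 - beta1) * (1 - beta1 / beta2)).
Proof.
rewrite /q exchange_big /= -[n in leRHS]card_ord -sum1_card natr_sum !mulr_suml.
apply: ler_sum => i _; rewrite mul1r mulrC.
apply: le_trans (sum_normalized_momentum_sqr_le b1_ge0 b12 b2_lt1 eps_gt0 (r00 i)
  (s00 i) (run_first_moment^~ i) (run_second_moment^~ i) K) _.
apply: ler_wpM2l; last exact: sum_normalized_entry_le.
by rewrite invr_ge0 mulr_ge0 // ltW.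
Qed.

(** The Lipschitz bound on the projected gradient and Jensen's inequality for the
    [k] intermediate steps. *)
Lemma sqr_norm2_gradient_drift t k : (k <= t)%N ->
  norm2 (G t - G (t - k)) ^+ 2 <=
  L_Pf ^+ 2 * alpha ^+ 2 *
    (k%:R * (k%:R * V + etab ^+ 2 * \sum_(l < k) q (t - l.+1))).
Proof.
move=> kt.
have /andP[a0 _] := alpha01.
have xE : x t.+1 - x (t - k).+1 = alpha *: \sum_(l < k) d (t - l.+1).+1.
  elim: k kt => [_|k IH kt]; first by rewrite big_ord0 scaler0 subn0 subrr.
  rewrite big_ord_recr /= scalerDr -(IH (ltnW kt)).
  have -> : (t - k)%N = (t - k.+1).+1 by rewrite subnSK.
  by rewrite [x _.+2](run_x run) // opprD addrA subrK.
apply: (@le_trans _ _ ((L_Pf * norm2 (x t.+1 - x (t - k).+1)) ^+ 2)).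
  rewrite ler_sqr ?nnegrE ?norm2_ge0 ?mulr_ge0 ?norm2_ge0 ?(ltW L_Pf_gt0) //.
  exact: Pgradf_lip.
rewrite exprMn -mulrA; apply: ler_wpM2l; first exact: sqr_ge0.
rewrite xE norm2Z exprMn real_normK ?num_real //.
apply: ler_wpM2l; first exact: sqr_ge0.
apply: (@le_trans _ _ (k%:R * \sum_(l < k) norm2 (d (t - l.+1).+1) ^+ 2)).
  rewrite sqr_norm2 /dotv.
  under [X in _ <= _ * X]eq_bigr do rewrite sqr_norm2 /dotv.
  rewrite exchange_big /= mulr_sumr; apply: ler_sum => i _.
  rewrite summxE -expr2.
  have := sum_cauchy_schwarz (index_enum 'I_k) (fun=> 1)
    (fun l : 'I_k => d (t - l.+1).+1 0 i).
  have -> : \sum_(l < k) 1 * d (t - l.+1).+1 0 i = \sum_(l < k) d (t - l.+1).+1 0 i.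
    by apply: eq_bigr => l _; rewrite mul1r.
  rewrite sumr_const card_ord expr1n => /le_trans; apply.
  by rewrite ler_wpM2l //; apply: ler_sum => l _; rewrite expr2.
apply: ler_wpM2l => //.
apply: (@le_trans _ _ (\sum_(l < k) (V + etab ^+ 2 * q (t - l.+1)))).
  by apply: ler_sum => l _; exact: sqr_norm2_step.
by rewrite big_split /= sumr_const card_ord mulr_natl mulr_sumr.
Qed.

Let q_ge0 t : 0 <= q t.
Proof.
apply: sumr_ge0 => i _; rewrite divr_ge0 ?sqr_ge0 // addr_ge0 //; exact: ltW.
Qed.

Let V_ge0 : 0 <= V. Proof. exact: sqr_ge0. Qed.

Let drift_bound K := L_Pf ^+ 2 * alpha ^+ 2 *
  (K%:R * V * (beta1 * (1 + beta1) / (1 - beta1) ^+ 3)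
   + etab ^+ 2 * (4 * beta1 / ((1 - beta1) ^+ 2 * Num.sqrt (1 - beta1))) *
     (n%:R * Lam K / ((1 - beta1) * (1 - beta1 / beta2)))).

Let sqr_norm2B (y z : 'rV[R]_n) :
  norm2 (y - z) ^+ 2 = \sum_(i < n) (y 0 i - z 0 i) ^+ 2.
Proof. by rewrite sqr_norm2; apply: eq_bigr => i _; rewrite !mxE expr2. Qed.

Lemma sum_gradient_drift_le K :
  \sum_(i < n) \sum_(t < K) \sum_(k < t.+1)
     beta1 ^+ k / Num.sqrt k.+1%:R * (G t 0 i - G (t - k) 0 i) ^+ 2 <=
  drift_bound K.
Proof.
have b01 : 0 <= beta1 < 1 by rewrite b1_ge0 -subr_gt0.
pose w k : R := beta1 ^+ k * (k%:R / Num.sqrt k.+1%:R).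
have w_ge0 k : 0 <= w k by rewrite mulr_ge0 ?exprn_ge0 // divr_ge0 ?sqrtr_ge0.
apply: (@le_trans _ _ (L_Pf ^+ 2 * alpha ^+ 2 *
  (\sum_(t < K) \sum_(k < t.+1) w k * k%:R * V + etab ^+ 2 *
    \sum_(t < K) \sum_(k < t.+1) w k * \sum_(l < k) q (t - l.+1)))).
  rewrite exchange_big mulr_sumr -big_split mulr_sumr /=; apply: ler_sum => t _.
  rewrite exchange_big mulr_sumr -big_split mulr_sumr /=; apply: ler_sum => k _.
  rewrite -mulr_sumr.
  have -> : \sum_(i < n) (G t 0 i - G (t - k) 0 i) ^+ 2 = norm2 (G t - G (t - k)) ^+ 2.
    by rewrite sqr_norm2B.
  have kt : (k <= t)%N by rewrite -ltnS.
  have c0 : 0 <= beta1 ^+ k / Num.sqrt k.+1%:R.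
    by rewrite divr_ge0 ?exprn_ge0 ?sqrtr_ge0.
  have := ler_wpM2l c0 (sqr_norm2_gradient_drift kt).
  set N2 := norm2 _ ^+ 2; set Q := \sum_(l < k) _; rewrite /w => /le_trans; apply.
  by rewrite le_eqVlt; apply/orP; left; apply/eqP; ring.
apply: ler_wpM2l; first by rewrite mulr_ge0 ?sqr_ge0.
apply: lerD.
  rewrite -mulrA -[K in leRHS]card_ord -sum1_card natr_sum mulr_suml.
  apply: ler_sum => t _; rewrite mul1r -mulr_suml mulrC ler_wpM2l //.
  exact: sum_geometric_quot_le.
rewrite -mulrA; apply: ler_wpM2l; first exact: sqr_ge0.
apply: le_trans (sum_lagged_window_le w_ge0 q_ge0 (sum_geometric_quot_sqrt_le K b01)) _.
apply: ler_wpM2l; last exact: sum_q_le.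
by apply: divr_ge0; apply: mulr_ge0; rewrite ?sqr_ge0 ?sqrtr_ge0.
Qed.

(** Telescopes [merit_decrease] and inserts the bound on the Adam part in each
    coordinate. *)
Lemma pathwise_bound K :
  alpha * tau * \sum_(t < K) (h_min * (1 - beta1) / (2 * h_max * S) * norm2 (G t) ^+ 2
                + rho_min * norm1 (c (x t.+1))) <=
  merit f c x1 tau - tau * finf
  + alpha * tau * (noise K
    + etab * (Num.sqrt (1 - beta1) / (4 * S)) * drift_bound K
    + etab * (3 / 2 * S * (h_max / h_min) / Num.sqrt (1 - beta1)) /
      ((1 - beta1 / beta2) * Num.sqrt (1 - beta1 / beta2)) * (n%:R * Lam K))
  + (tau * L_f + L_J) / 2 * alpha ^+ 2 *
     (K%:R * V + etab ^+ 2 * (n%:R * Lam K / ((1 - beta1) * (1 - beta1 / beta2)))).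
Proof.
have /andP[a0 a1] := alpha01.
have sb1 : 0 <= Num.sqrt (1 - beta1) by exact: sqrtr_ge0.
have etab_ge0 : 0 <= etab by exact: le_trans (eta_ge0 0) (eta_le 0).
have h_max_gt0 : 0 < h_max.
  by have /andP[/(lt_le_trans h_min_gt0)/lt_le_trans h1 /h1] := h_bnd 0.
pose A t := \sum_(i < n) G t 0 i * r t.+1 0 i / Num.sqrt (s t.+1 0 i + eps).
have tel : merit f c (x K.+1) tau <= merit f c x1 tau
    - alpha * tau * rho_min * (\sum_(t < K) norm1 (c (x t.+1)))
    + alpha * tau * (\sum_(t < K) eta beta1 beta2 t.+1 * A t)
    + (tau * L_f + L_J) / 2 * alpha ^+ 2 * (K%:R * V + etab ^+ 2 * \sum_(t < K) q t).
  elim: K => [|K IH].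
    by rewrite !big_ord0 (run_x1 run); lra.
  rewrite !big_ord_recr /= -natr1; have := merit_decrease K; rewrite -/(A K).
  move: IH; set B := (tau * _ + _) / 2 * _; lra.
have low : tau * finf <= merit f c (x K.+1) tau.
  rewrite /merit -[leLHS]addr0; apply: lerD; first by rewrite ler_pM2l // f_lb.
  exact: sumr_ge0.
have Q_le := sum_q_le K.
have B_ge0 : 0 <= (tau * L_f + L_J) / 2 * alpha ^+ 2 * etab ^+ 2.
  have TL : 0 <= tau * L_f + L_J.
    by apply: addr_ge0; [apply: mulr_ge0|]; exact: ltW.
  apply: mulr_ge0; last exact: sqr_ge0.
  by apply: mulr_ge0; [apply: divr_ge0|exact: sqr_ge0].
have Q_le' := ler_wpM2l B_ge0 Q_le.
have main : \sum_(t < K) eta beta1 beta2 t.+1 * A t <=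
   noise K - h_min * (1 - beta1) / (2 * h_max * S) * (\sum_(t < K) norm2 (G t) ^+ 2)
    + etab * (Num.sqrt (1 - beta1) / (4 * S)) * drift_bound K
    + etab * (3 / 2 * S * (h_max / h_min) / Num.sqrt (1 - beta1)) /
      ((1 - beta1 / beta2) * Num.sqrt (1 - beta1 / beta2)) * (n%:R * Lam K).
  have := sum_gradient_drift_le K; set DS := \sum_(i < n) _ => drift.
  have c1 : 0 <= etab * (Num.sqrt (1 - beta1) / (4 * S)).
    by rewrite mulr_ge0 // divr_ge0 // mulr_ge0 // ltW.
  set C2 := etab * (3 / 2 * S * (h_max / h_min) / Num.sqrt (1 - beta1)) / _.
  have c2 : 0 <= C2.
    by rewrite /C2 !(mulr_ge0, invr_ge0) ?sqrtr_ge0 ?(ltW S_gt0)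
      ?(ltW h_max_gt0) ?(ltW h_min_gt0) ?(ltW q1') ?(ltW b1') ?ler0n.
  have ent : \sum_(i < n) \sum_(t < K) u t.+1 0 i ^+ 2 / (s t.+1 0 i + eps) <= n%:R * Lam K.
    rewrite -[n in leRHS]card_ord -sum1_card natr_sum mulr_suml.
    by apply: ler_sum => i _; rewrite mul1r; exact: sum_normalized_entry_le.
  apply: (@le_trans _ _ (noise K - h_min * (1 - beta1) / (2 * h_max * S)
        * (\sum_(t < K) norm2 (G t) ^+ 2)
      + etab * (Num.sqrt (1 - beta1) / (4 * S)) * DS + C2 *
      \sum_(i < n) \sum_(t < K) u t.+1 0 i ^+ 2 / (s t.+1 0 i + eps))); last first.
    by have := ler_wpM2l c1 drift; have := ler_wpM2l c2 ent; lra.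
  under eq_bigr do rewrite /A mulr_sumr.
  rewrite exchange_big /=.
  have -> : \sum_(t < K) norm2 (G t) ^+ 2 = \sum_(i < n) \sum_(t < K) G t 0 i ^+ 2.
    rewrite exchange_big /=; apply: eq_bigr => t _; rewrite sqr_norm2.
    by apply: eq_bigr => i _; rewrite expr2.
  rewrite /noise /DS !mulr_sumr -sumrB -!big_split /=; apply: ler_sum => i _.
  have := momentum_inner_product_le b1_ge0 b12 b2_lt1 eps_gt0 (r00 i) (s00 i)
    (run_first_moment^~ i) (run_second_moment^~ i) (fun t => G t 0 i)
    S_gt0 h_min_gt0 h_bnd (u_bnd^~ i) K.
  move=> /= /le_trans; apply; rewrite -/etab -/C2 !lerD2r.
  rewrite le_eqVlt; apply/orP; left; apply/eqP.
  by apply: eq_bigr => t _; apply: eq_bigr => k _; rewrite /noise_weight; ring.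
have main' := ler_wpM2l (ltW (mulr_gt0 a0 tau_gt0)) main.
rewrite big_split /= -!mulr_sumr.
move: tel low Q_le' main'; set QQ := _ / ((1 - beta1) * _).
set E1 := etab * _ * drift_bound K; set E2 := _ * (n%:R * Lam K).
lra.
Qed.

End Run.

(** * Accounting of the constants *)

(** The two sides agree term by term, except for the coefficient of the
    [u ^+ 2] errors, which is [3 / 2] on the left and [6] on the right. *)
Lemma rate_constants (R : realFieldType)
    (a b e S tau alpha beta1 L_Pf L_f L_J rho kc sigma hmin hmax N Lam K phi : R) :
  0 < a -> 0 < b -> 0 < e -> 0 < S -> 0 < tau -> 0 < alpha -> 0 < sigma ->
  0 < hmin -> 0 < hmax -> 0 < K -> 0 <= N -> 0 <= Lam ->
  (phi + alpha * tau * (a ^+ 2 / b * (a / (4 * S)) *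
      (L_Pf ^+ 2 * alpha ^+ 2 *
        (K * (rho * kc / sigma) ^+ 2 * (beta1 * (1 + beta1) / (a ^+ 2) ^+ 3)
         + (a ^+ 2 / b) ^+ 2 * (4 * beta1 / ((a ^+ 2) ^+ 2 * a)) *
           (N * Lam / (a ^+ 2 * e ^+ 2))))
      + a ^+ 2 / b * (3 / 2 * S * (hmax / hmin) / a) / (e ^+ 2 * e) * (N * Lam))
    + (tau * L_f + L_J) / 2 * alpha ^+ 2 * (K * (rho * kc / sigma) ^+ 2
        + (a ^+ 2 / b) ^+ 2 * (N * Lam / (a ^+ 2 * e ^+ 2)))) / (alpha * tau * K)
  <= phi / (alpha * tau * K)
    + 6 * hmax * S * a / (hmin * b) * (N / (e ^+ 2 * e)) * (Lam / K)
    + (alpha ^+ 2 / tau * (tau * beta1 * L_Pf ^+ 2 / ((b ^+ 2 * b) * S))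
       + alpha / tau * (a ^+ 2 * (tau * L_f + L_J) / (2 * b ^+ 2)))
      * (N / e ^+ 2) * (Lam / K)
    + alpha ^+ 2 / tau * (tau * L_Pf ^+ 2 * rho ^+ 2 * kc ^+ 2 * a * beta1
        * (1 + beta1) / (4 * S * b * (a ^+ 2) ^+ 2 * sigma ^+ 2))
    + alpha / tau * ((tau * L_f + L_J) * rho ^+ 2 * kc ^+ 2 / (2 * sigma ^+ 2)).
Proof.
move=> a0 b0 e0 S0 t0 al0 s0 h0 H0 K0 N0 Lam0.
rewrite -subr_ge0.
rewrite (_ : _ - _ = 9 / 2 *
    (hmax * S * a / (hmin * b) * (N / (e ^+ 2 * e)) * (Lam / K))).
  by rewrite !(mulr_ge0, invr_ge0) ?sqr_ge0 ?(ltW a0) ?(ltW b0) ?(ltW e0)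
    ?(ltW S0) ?(ltW h0) ?(ltW H0) ?(ltW K0) ?ler0n.
by field; rewrite !gt_eqF.
Qed.

(** * Measurability of the run and mean of the noise *)

Section RunMeasurable.
Context {R : realType} {n m : nat}.
Variables (c : 'rV[R]_n -> 'rV[R]_m).
Variables (x1 : 'rV[R]_n) (rho h : nat -> R) (beta1 beta2 alpha eps : R).
Variable X : set 'rV[R]_n.
Hypothesis Xopen : open X.
Hypothesis c_diff : forall y, X y -> differentiable c y.
Hypothesis c_C1 : forall y, X y -> {for y, continuous (jac c)}.
Hypothesis c_reg : forall y, X y -> jac c y *m (jac c y)^T \in unitmx.

Section Point.
Context {dT : measure_display} {T : measurableType dT}.
Variable x : T -> 'rV[R]_n.
Hypotheses (xX : forall w, X (x w)) (mx : measurable_mx x).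

Lemma measurable_jac : measurable_mx (fun w => jac c (x w)).
Proof.
move=> i j; apply: (@measurable_continuous_comp _ _ _ _ x X (fun y => jac c y i j)) => //.
move=> y Xy; apply: (@continuous_comp _ _ _ (jac c) (fun A : 'M[R]_(m, n) => A i j)).
  exact: c_C1.
exact: coord_continuous.
Qed.

Lemma measurable_constraint : measurable_mx (fun w => c (x w)).
Proof.
move=> i j; rewrite (ord1 i).
apply: (@measurable_continuous_comp _ _ _ _ x X (fun y => c y 0 j)) => //.
move=> y Xy; apply: (@continuous_comp _ _ _ c (fun A : 'rV[R]_m => A 0 j)).
  exact/differentiable_continuous/c_diff.
exact: coord_continuous.
Qed.

Lemma measurable_Pmx : measurable_mx (fun w => Pmx c (x w)).
Proof.
rewrite (_ : (fun w => Pmx c (x w)) = fun w =>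
    1%:M + (-1) *: (Defs.pinv (jac c (x w)) *m jac c (x w))); last first.
  by apply/funext => w; rewrite scaleN1r.
apply: measurable_addmx; first by move=> i j; exact: measurable_cst.
apply: measurable_scalemx; first exact: measurable_cst.
apply: measurable_mulmx; last exact: measurable_jac.
by apply: measurable_pinv; [move=> w; exact: c_reg|exact: measurable_jac].
Qed.

End Point.

(** Over an arbitrary space [T], so that it applies both to the full
    sigma-algebra and to the one generated by the first gradient estimates. *)
Lemma run_measurable {dT : measure_display} {T : measurableType dT}
    (g x v u r s d : nat -> T -> 'rV[R]_n) (N : nat) :
  (forall w, adam_sqp_run c x1 rho h beta1 beta2 alpha eps
    (g ^~ w) (x ^~ w) (v ^~ w) (u ^~ w) (r ^~ w) (s ^~ w) (d ^~ w)) ->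
  (forall k w, X (x k.+1 w)) ->
  (forall k, (0 < k < N)%N -> measurable_mx (g k)) ->
  forall t, (t < N)%N ->
    [/\ measurable_mx (x t.+1), measurable_mx (r t) & measurable_mx (s t)].
Proof.
move=> run xX mg; elim=> [_|t IH tN].
  rewrite (_ : x 1%N = cst x1); last by apply/funext => w; exact: run_x1 (run w).
  rewrite (_ : r 0%N = cst 0); last by apply/funext => w; exact: run_r0 (run w).
  rewrite (_ : s 0%N = cst 0); last by apply/funext => w; exact: run_s0 (run w).
  by split=> i j; exact: measurable_cst.
have [mx mr ms] := IH (ltnW tN).
have mgt := mg t.+1 tN.
have mP := measurable_Pmx (xX t) mx.
have mu : measurable_mx (u t.+1).
  rewrite (_ : u t.+1 = fun w => - (h t.+1)^-1 *: (Pmx c (x t.+1 w) *v g t.+1 w)).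
    by apply: measurable_scalemx; [exact: measurable_cst|exact: measurable_mxact].
  by apply/funext => w; rewrite (run_u (run w)).
have mr' : measurable_mx (r t.+1).
  rewrite (_ : r t.+1 = fun w => beta1 *: r t w + u t.+1 w).
    apply: measurable_addmx => //.
    by apply: measurable_scalemx => //; exact: measurable_cst.
  by apply/funext => w; rewrite (run_r (run w)).
have ms' : measurable_mx (s t.+1).
  rewrite (_ : s t.+1 = fun w => beta2 *: s t w + map2_mx *%R (u t.+1 w) (u t.+1 w)).
    apply: measurable_addmx; first by apply: measurable_scalemx => //; exact: measurable_cst.
    by move=> i j; under eq_fun do rewrite mxE; exact: measurable_funM.
  by apply/funext => w; rewrite (run_s (run w)).
have mv : measurable_mx (v t.+1).
  rewrite (_ : v t.+1 = fun w =>
      - rho t.+1 *: (Defs.pinv (jac c (x t.+1 w)) *v c (x t.+1 w))).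
    apply: measurable_scalemx; first exact: measurable_cst.
    apply: measurable_mxact; last exact: measurable_constraint.
    by apply: measurable_pinv; [move=> w; exact: c_reg|exact: measurable_jac].
  by apply/funext => w; rewrite (run_v (run w)).
have md : measurable_mx (d t.+1).
  rewrite (_ : d t.+1 = fun w => v t.+1 w + eta beta1 beta2 t.+1 *:
      ((Pmx c (x t.+1 w) *m scaling eps (s t.+1 w)) *v r t.+1 w)).
    apply: measurable_addmx => //; apply: measurable_scalemx; first exact: measurable_cst.
    apply: measurable_mxact => //; apply: measurable_mulmx => //.
    move=> i j; rewrite /scaling; under eq_fun do rewrite !mxE.
    have [_|_] := eqVneq i j; last first.
      by under eq_fun do rewrite mulr0n; exact: measurable_cst.
    under eq_fun do rewrite mulr1n.
    apply/measurable_inv/measurable_sqrt; exact: measurable_funD.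
  by apply/funext => w; rewrite (run_d (run w)).
split => //.
rewrite (_ : x t.+2 = fun w => x t.+1 w + alpha *: d t.+1 w).
  apply: measurable_addmx => //.
  by apply: measurable_scalemx => //; exact: measurable_cst.
by apply/funext => w; rewrite (run_x (run w)).
Qed.

End RunMeasurable.

Section Noise.
Context {R : realType} {n m : nat} {dO : measure_display} {Omega : measurableType dO}.
Variable P : probability Omega R.
Variables (f : 'rV[R]_n -> R) (c : 'rV[R]_n -> 'rV[R]_m).
Variables (x1 : 'rV[R]_n) (rho h : nat -> R) (beta1 beta2 alpha eps : R).
Variables g x v u r s d : nat -> Omega -> 'rV[R]_n.
Hypothesis mg : forall k, (0 < k)%N -> forall i : 'I_n,
  measurable_fun setT (fun w => g k w 0 i).
Hypothesis run : forall w, adam_sqp_run c x1 rho h beta1 beta2 alpha eps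
    (g ^~ w) (x ^~ w) (v ^~ w) (u ^~ w) (r ^~ w) (s ^~ w) (d ^~ w).
Hypotheses (b1_ge0 : 0 <= beta1) (b12 : beta1 < beta2) (b2_lt1 : beta2 < 1).
Hypothesis eps_gt0 : 0 < eps.
Variable X : set 'rV[R]_n.
Hypothesis Xopen : open X.
Hypothesis c_diff : forall y, X y -> differentiable c y.
Hypothesis c_C1 : forall y, X y -> {for y, continuous (jac c)}.
Hypothesis c_reg : forall y, X y -> jac c y *m (jac c y)^T \in unitmx.
Hypothesis xX : forall k w, X (x k.+1 w).
Variable kappa_f : R.
Hypothesis gradf_ub : forall y, X y -> norm2 (grad f y) <= kappa_f.
Hypothesis g_unbiased : forall k, (0 < k)%N -> forall i : 'I_n,
  is_cond_exp P (history g k)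
    (fun w => (Pmx c (x k w) *v g k w) 0 i)
    (fun w => (Pmx c (x k w) *v grad f (x k w)) 0 i).
Variables S h_min : R.
Hypothesis u_bnd : forall k w i, (u k.+1 w 0 i) ^+ 2 <= (S / h_min) ^+ 2 - eps.

Lemma history_measurable k A : history g k A -> measurable A.
Proof.
apply: smallest_sub; first exact: sigma_algebra_measurable.
move=> _ [j [i [B [/andP[j0 _] mB ->]]]].
by rewrite -[X in measurable X]setTI; exact: mg.
Qed.

Let history_gen k : set (set Omega) :=
  [set A | exists (j : nat) (i : 'I_n) (B : set R),
         [/\ (0 < j < k)%N, measurable B & A = (fun w => g j w 0 i) @^-1` B]].

Lemma history_run_measurable k :
  @measurable_mx _ _ (g_sigma_algebraType (history_gen k.+1)) _ _ (x k.+1) /\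
  @measurable_mx _ _ (g_sigma_algebraType (history_gen k.+1)) _ _ (s k).
Proof.
have [] := @run_measurable _ _ _ _ _ _ _ _ _ _ _ _ Xopen c_diff c_C1 c_reg
  _ (g_sigma_algebraType (history_gen k.+1)) g x v u r s d k.+1 run xX _ k (ltnSn k).
  move=> j jk i l; rewrite (ord1 i) => _ B mB; rewrite setTI.
  by apply: sub_sigma_algebra; exists j, l, B.
by [].
Qed.

Lemma norm_entry_le (y : 'rV[R]_n) i : `|y 0 i| <= norm2 y.
Proof.
rewrite -(@ler_pXn2r _ 2) ?nnegrE ?norm2_ge0 // real_normK ?num_real //.
rewrite sqr_norm2 /dotv (bigD1 i) //= -expr2 lerDl.
by apply: sumr_ge0 => j _; rewrite -expr2 sqr_ge0.
Qed.

Lemma norm2_projected_gradient_le k w :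
  norm2 (Pmx c (x k.+1 w) *v grad f (x k.+1 w)) <= kappa_f.
Proof.
apply: le_trans (norm2_proj_le _ _) (gradf_ub (xX k w)).
exact/c_reg/xX.
Qed.

Lemma surrogate_ge0 w i t k :
  0 <= surrogate beta2 eps (fun j => s j w 0 i) S h_min t k.
Proof.
have b2_gt0 : 0 < beta2 by exact: le_lt_trans b1_ge0 b12.
rewrite /surrogate addr_ge0 //.
  rewrite mulr_ge0 ?exprn_ge0 ?(ltW b2_gt0) //.
  apply: (@second_moment_ge0 _ beta1 beta2 (fun j => u j.+1 w 0 i)
    (fun j => s j w 0 i)) => //.
    by rewrite (run_s0 (run w)) mxE.
  by move=> j; exact: run_second_moment (run w) j i.
rewrite mulr_ge0 //; first exact: le_trans (sqr_ge0 _) (u_bnd 0 w i).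
by apply: sumr_ge0 => j _; rewrite exprn_ge0 ?(ltW b2_gt0).
Qed.

(** The weight of [u (t - k).+1] is a function of the gradient estimates
    drawn before it, because the surrogate denominator is. *)
Lemma noise_term_mean t k i :
  let Z w := noise_weight f c beta1 beta2 eps (x ^~ w) (s ^~ w) S h_min t k i *
    (u (t - k).+1 w 0 i
     + (Pmx c (x (t - k).+1 w) *v grad f (x (t - k).+1 w)) 0 i / h (t - k).+1) in
  P.-integrable setT (EFin \o Z) /\ \int[P]_w Z w = 0.
Proof.
move=> Z; set j := (t - k)%N.
pose W w := noise_weight f c beta1 beta2 eps (x ^~ w) (s ^~ w) S h_min t k i.
pose b := - (h j.+1)^-1.
have b2_gt0 : 0 < beta2 by exact: le_lt_trans b1_ge0 b12.
have eta_ge0 : 0 <= eta beta1 beta2 t.+1.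
  have b1' : 0 <= 1 - beta1 by rewrite subr_ge0; exact/ltW/(lt_trans b12).
  by apply: divr_ge0; [apply: mulr_ge0|]; rewrite ?sqrtr_ge0.
have etak_ge0 := mulr_ge0 eta_ge0 (exprn_ge0 k b1_ge0).
have ZE : Z = fun w => b * W w * ((Pmx c (x j.+1 w) *v g j.+1 w) 0 i
   - (Pmx c (x j.+1 w) *v grad f (x j.+1 w)) 0 i).
  apply/funext => w; rewrite /Z -/(W w) -/j (run_u (run w)) //.
  have entryZ (a : R) (y : 'rV[R]_n) : (a *: y) 0 i = a * y 0 i by rewrite mxE.
  by rewrite entryZ /b; ring.
pose C := `|b| * (eta beta1 beta2 t.+1 * beta1 ^+ k * (kappa_f / Num.sqrt eps)).
have bW w : `|b * W w| <= C.
  rewrite normrM /C; apply: ler_wpM2l => //.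
  rewrite /W /noise_weight normrM (ger0_norm etak_ge0).
  apply: ler_wpM2l => //.
  rewrite normrM; apply: ler_pM => //.
    exact: le_trans (norm_entry_le _ _) (norm2_projected_gradient_le j w).
  rewrite ger0_norm ?invr_ge0 ?sqrtr_ge0 // lef_pV2 ?posrE ?sqrtr_gt0 //.
    by rewrite ler_sqrt ?lerDr ?surrogate_ge0 // addr_ge0 ?surrogate_ge0 // ltW.
  by rewrite ltr_wpDl // surrogate_ge0.
have [_ _ mY _] := g_unbiased (ltn0Sn j) i.
have [_ ms] := history_run_measurable j.
pose T := g_sigma_algebraType (history_gen j.+1).
have mG : @measurable_fun _ _ T R setT
    (fun w => (Pmx c (x j.+1 w) *v grad f (x j.+1 w)) 0 i).
  by move=> _ B mB; rewrite setTI; exact: mY.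
have mbW : @measurable_fun _ _ T R setT (fun w => b * W w).
  rewrite /W /noise_weight -/j.
  apply: measurable_funM; first exact: measurable_cst.
  apply: measurable_funM; first exact: measurable_cst.
  apply: measurable_funM; first exact: mG.
  apply/measurable_inv/measurable_sqrt; rewrite /surrogate -/j.
  apply: measurable_funD; last exact: measurable_cst.
  apply: measurable_funD; last exact: measurable_cst.
  by apply: measurable_funM; [exact: measurable_cst|exact: ms].
rewrite ZE; apply: (cond_exp_orthogonal (g_unbiased (ltn0Sn j) i) _ _ bW).
  by move=> A; exact: history_measurable.
by move=> B mB; have := mbW measurableT B mB; rewrite setTI.
Qed.

End Noise.

Lemma Rintegral_sum {R : realType} {dO : measure_display}
    {Omega : measurableType dO} (P : probability Omega R) (I : Type)
    (l : seq I) (F : I -> Omega -> R) :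
  (forall i, P.-integrable setT (EFin \o F i)) ->
  P.-integrable setT (EFin \o (fun w => \sum_(i <- l) F i w)) /\
  \int[P]_w (\sum_(i <- l) F i w) = \sum_(i <- l) \int[P]_w F i w.
Proof.
move=> iF; elim: l => [|i l [iS IH]].
  rewrite big_nil (_ : (fun w => \sum_(i <- [::]) F i w) = cst 0).
    split; first exact: finite_measure_integrable_cst.
    by rewrite Rintegral_cst ?mul0r.
  by apply/funext => w; rewrite big_nil.
rewrite big_cons -IH -RintegralD // (_ : (fun w => \sum_(i0 <- i :: l) F i0 w) =
  fun w => F i w + \sum_(j <- l) F j w).
  by split => //; exact: (integrableD measurableT (iF i) iS).
by apply/funext => w; rewrite big_cons.
Qed.

(** * The complexity bound *)

Unset Implicit Arguments.

Theorem theorem3p2 (R : realType) (n m : nat)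
  (* problem: f(x) = E_xi[F(x, xi)], with Q the law of xi, and c(x) = 0 *)
  (dXi : measure_display) (Xi : measurableType dXi) (Q : probability Xi R)
  (F : 'rV[R]_n -> Xi -> R) (f : 'rV[R]_n -> R) (c : 'rV[R]_n -> 'rV[R]_m)
  (hF : forall x, Q.-integrable setT (EFin \o F x))
  (hf : forall x, (f x)%:E = 'E_Q[F x]%E)
  (hmn : (m <= n)%N)
  (* inputs of the algorithm *)
  (x1 : 'rV[R]_n) (rho h : nat -> R) (beta1 beta2 alpha eps : R)
  (hrho : forall k, (0 < k)%N -> 0 < rho k <= 1)
  (hh : forall k, (0 < k)%N -> 0 < h k)
  (hbeta1 : 0 <= beta1 < 1) (hbeta2 : beta1 < beta2 < 1)
  (halpha : 0 < alpha <= 1) (heps : 0 < eps)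
  (* probability space, gradient estimates and the process they generate *)
  (dO : measure_display) (Omega : measurableType dO) (P : probability Omega R)
  (g x v u r s d : nat -> Omega -> 'rV[R]_n)
  (hg : forall k, (0 < k)%N -> forall i : 'I_n,
    measurable_fun setT (fun w => g k w 0 i))
  (hrun : forall w, adam_sqp_run c x1 rho h beta1 beta2 alpha eps
    (g ^~ w) (x ^~ w) (v ^~ w) (u ^~ w) (r ^~ w) (s ^~ w) (d ^~ w))
  (* the open convex set containing the iterates, smoothness and bounds *)
  (X : set 'rV[R]_n) (Xopen : open X)
  (Xconvex : convex_set (X : set (convex_lmodType 'rV[R]_n)))
  (hX : forall k w, (0 < k)%N -> X (x k w))
  (finf kappa_c kappa_f kappa_J L_f hatL_J sigma_min : R)
  (hkappa_c : 0 < kappa_c) (hkappa_f : 0 < kappa_f) (hkappa_J : 0 < kappa_J)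
  (hL_f : 0 < L_f) (hhatL_J : 0 < hatL_J) (hsigma_min : 0 < sigma_min)
  (f_diff : forall y, X y -> differentiable f y)
  (f_C1 : forall y, X y -> {for y, continuous (grad f)})
  (f_lb : forall y, X y -> finf <= f y)
  (c_diff : forall y, X y -> differentiable c y)
  (c_C1 : forall y, X y -> {for y, continuous (jac c)})
  (c_ub : forall y, X y -> norm2 (c y) <= kappa_c)
  (gradf_ub : forall y, X y -> norm2 (grad f y) <= kappa_f)
  (J_ub : forall y, X y -> spectral_norm (jac c y) <= kappa_J)
  (gradf_lip : forall y z, X y -> X z ->
    norm2 (grad f y - grad f z) <= L_f * norm2 (y - z))
  (J_lip : forall y z, X y -> X z ->
    spectral_norm (jac c y - jac c z) <= hatL_J * norm2 (y - z))
  (J_sigma : forall y, X y -> sigma_min <= smallest_singular_value (jac c y))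
  (* stochastic gradient assumptions *)
  (M : R)
  (g_unbiased : forall k, (0 < k)%N -> forall i : 'I_n,
    is_cond_exp P (history g k)
      (fun w => (Pmx c (x k w) *v g k w) 0 i)
      (fun w => (Pmx c (x k w) *v grad f (x k w)) 0 i))
  (g_variance : forall k, (0 < k)%N -> exists Y : Omega -> R,
    is_cond_exp P (history g k)
      (fun w => norm2 (Pmx c (x k w) *v (g k w - grad f (x k w))) ^+ 2) Y /\
    {ae P, forall w, Y w <= M ^+ 2})
  (rho_min rho_max h_min h_max : R)
  (hrho_min : 0 < rho_min <= 1) (hrho_max : 0 < rho_max <= 1)
  (hh_min : 0 < h_min) (hh_max : 0 < h_max)
  (rho_bnd : forall k, (0 < k)%N -> rho_min <= rho k <= rho_max)
  (h_bnd : forall k, (0 < k)%N -> h_min <= h k <= h_max)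
  (u_rad : forall k, (0 < k)%N ->
    0 <= (M ^+ 2 + kappa_f ^+ 2) / h k ^+ 2 - eps)
  (u_bnd : forall k w, (0 < k)%N ->
    `|u k w| <= Num.sqrt ((M ^+ 2 + kappa_f ^+ 2) / h k ^+ 2 - eps))
  (* derived Lipschitz-type constants *)
  (L_J L_Pf : R) (hL_J : 0 < L_J) (hL_Pf : 0 < L_Pf)
  (c_descent : forall y z, X y -> X z ->
    norm1 (c z) <=
      norm1 (c y + jac c y *v (z - y)) + 2^-1 * L_J * norm2 (z - y) ^+ 2)
  (Pgradf_lip : forall y z, X y -> X z ->
    norm2 (Pmx c y *v grad f y - Pmx c z *v grad f z) <= L_Pf * norm2 (y - z)) :
  let tau : R := sigma_min * rho_min / (sigma_min * rho_min + kappa_f * rho_max) in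
  let SM : R := Num.sqrt (M ^+ 2 + kappa_f ^+ 2) in
  let G1 : R := tau * beta1 * L_Pf ^+ 2 / ((1 - beta2) `^ (3 / 2) * SM) in
  let G2 : R := (1 - beta1) * (tau * L_f + L_J) / (2 * (1 - beta2)) in
  let G3 : R := tau * L_Pf ^+ 2 * rho_max ^+ 2 * kappa_c ^+ 2
              * Num.sqrt (1 - beta1) * beta1 * (1 + beta1)
            / (4 * SM * Num.sqrt (1 - beta2) * (1 - beta1) ^+ 2
                 * sigma_min ^+ 2) in
  let G4 : R := (tau * L_f + L_J) * rho_max ^+ 2 * kappa_c ^+ 2
            / (2 * sigma_min ^+ 2) in
  forall K : nat, (0 < K)%N ->
  let logs : R := K%:R^-1 * ln (1 + (M ^+ 2 + kappa_f ^+ 2)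
                                / (h_min ^+ 2 * (1 - beta2) * eps))
              - ln beta2 in
  ((K%:R^-1)%:E *
     \sum_(1 <= k < K.+1)
       ((h_min * (1 - beta1) / (2 * h_max * SM))%:E
          * 'E_P[(fun w => norm2 (Pmx c (x k w) *v grad f (x k w)) ^+ 2)%R]
        + rho_min%:E * 'E_P[(fun w => norm1 (c (x k w)))%R])
   <=
   ((merit f c x1 tau - tau * finf) / (alpha * tau * K%:R)
    + 6 * h_max * SM * Num.sqrt (1 - beta1) / (h_min * Num.sqrt (1 - beta2))
      * (n%:R / (1 - beta1 / beta2) `^ (3 / 2)) * logs
    + (alpha ^+ 2 / tau * G1 + alpha / tau * G2)
      * (n%:R / (1 - beta1 / beta2)) * logs
    + alpha ^+ 2 / tau * G3 + alpha / tau * G4)%:E)%E.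
Proof.
move=> tau SM G1 G2 G3 G4 K K_gt0; cbv zeta.
set logs := K%:R^-1 * ln _ - ln beta2.
have /andP[b1_ge0 b1_lt1] := hbeta1; have /andP[b12 b2_lt1] := hbeta2.
have b2_gt0 : 0 < beta2 by exact: le_lt_trans b12.
have /andP[a_gt0 _] := halpha.
have SM2 : SM ^+ 2 = M ^+ 2 + kappa_f ^+ 2 by rewrite sqr_sqrtr // addr_ge0 ?sqr_ge0.
have SM_gt0 : 0 < SM by rewrite sqrtr_gt0 ltr_wpDl ?sqr_ge0 // exprn_gt0.
have /andP[rho_min_gt0 _] := hrho_min; have /andP[rho_max_gt0 rho_max1] := hrho_max.
have tau_gt0 : 0 < tau by rewrite divr_gt0 ?addr_gt0 ?mulr_gt0.
have at_gt0 := mulr_gt0 a_gt0 tau_gt0.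
have xX k w : X (x k.+1 w) by exact: hX.
have c_reg y : X y -> jac c y *m (jac c y)^T \in unitmx.
  by move=> Xy; apply: gram_unitmx; apply: lt_le_trans (J_sigma _ Xy).
have h_bnd' k : h_min <= h k.+1 <= h_max by exact: h_bnd.
have h_bnd_min k : h_min <= h k.+1 by have /andP[] := h_bnd' k.
have u_bnd' k w i : (u k.+1 w 0 i) ^+ 2 <= (SM / h_min) ^+ 2 - eps.
  have hk := lt_le_trans hh_min (h_bnd_min k).
  have entry : `|u k.+1 w 0 i| <= `|u k.+1 w|.
    rewrite [leRHS]/Num.norm /= mx_normrE.
    by apply/bigmax_geP; right => /=; exists (0, i).
  have ule := le_trans entry (u_bnd _ w (ltn0Sn k)).
  rewrite -real_normK ?num_real //.
  apply: le_trans (_ : ((M ^+ 2 + kappa_f ^+ 2) / h k.+1 ^+ 2 - eps) <= _).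
    by rewrite -(sqr_sqrtr (u_rad _ (ltn0Sn k))) ler_sqr ?nnegrE ?sqrtr_ge0.
  rewrite -SM2 lerD2r expr_div_n ler_wpM2l ?sqr_ge0 //.
  by rewrite lef_pV2 ?posrE ?exprn_gt0 // ler_sqr ?nnegrE ?(ltW hk) ?(ltW hh_min).
have h_max_gt0 : 0 < h_max := lt_le_trans hh_min (le_trans (h_bnd_min 0%N)
  (proj2 (andP (h_bnd' 0%N)))).
pose coef := h_min * (1 - beta1) / (2 * h_max * SM).
pose G t w := Pmx c (x t.+1 w) *v grad f (x t.+1 w).
pose N2 t w := norm2 (G t w) ^+ 2.
pose C1 t w := norm1 (c (x t.+1 w)).
pose nz w := noise f c h beta1 beta2 eps (x ^~ w) (u ^~ w) (s ^~ w) SM h_min K.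
have mx t : measurable_mx (x t.+1).
  have [] := run_measurable Xopen c_diff c_C1 c_reg hrun xX (N := t.+1) _ (ltnSn t).
    by move=> k /andP[k0 _] i j; rewrite (ord1 i); exact: hg.
  by [].
have iN2 t : P.-integrable setT (EFin \o N2 t).
  apply: (@integrable_bounded _ _ _ _ _ (kappa_f ^+ 2)).
    rewrite (_ : N2 t = fun w => \sum_(i < n) G t w 0 i ^+ 2); last first.
      by apply/funext => w; rewrite /N2 sqr_norm2; apply: eq_bigr => i _; rewrite expr2.
    apply: measurable_sum => i; apply: measurable_funX.
    have [_ iY _ _] := g_unbiased _ (ltn0Sn t) i.
    by apply/measurable_EFinP; case/integrableP : iY.
  move=> w; rewrite ger0_norm ?sqr_ge0 // ler_sqr ?nnegrE ?norm2_ge0 ?(ltW hkappa_f) //.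
  exact: (norm2_projected_gradient_le c_reg xX gradf_ub).
have iC1 t : P.-integrable setT (EFin \o C1 t).
  apply: (@integrable_bounded _ _ _ _ _ (\sum_(i < m) kappa_c)).
    apply: measurable_sum => i; apply: measurableT_comp => //.
    exact: (measurable_constraint Xopen c_diff (xX t) (mx t) 0 i).
  move=> w; rewrite ger0_norm; last exact: sumr_ge0.
  apply: ler_sum => i _; exact: le_trans (norm_entry_le _ _) (c_ub _ (xX t w)).
have EE (Y : Omega -> R) : P.-integrable setT (EFin \o Y) ->
    'E_P[Y]%E = (\int[P]_w Y w)%:E.
  by move=> iY; rewrite unlock /Rintegral fineK //; exact: integrable_fin_num iY.
pose obj t w := coef * N2 t w + rho_min * C1 t w.
have iobj t : P.-integrable setT (EFin \o obj t).
  exact: (integrableD measurableT (integrableZl measurableT coef (iN2 t))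
    (integrableZl measurableT rho_min (iC1 t))).
have Robj t : \int[P]_w obj t w = coef * \int[P]_w N2 t w + rho_min * \int[P]_w C1 t w.
  rewrite RintegralD //; last 2 first.
  - exact: (integrableZl measurableT coef (iN2 t)).
  - exact: (integrableZl measurableT rho_min (iC1 t)).
  by rewrite !RintegralZl.
have [iL RL] := Rintegral_sum (index_enum 'I_K) (fun t : 'I_K => iobj t).
have [iZ RZ] : P.-integrable setT (EFin \o nz) /\ \int[P]_w nz w = 0.
  have mean t k i := noise_term_mean hg hrun b1_ge0 b12 b2_lt1 heps Xopen c_diff
    c_C1 c_reg xX gradf_ub g_unbiased u_bnd' t k i.
  pose T t k i w := noise_weight f c beta1 beta2 eps (x ^~ w) (s ^~ w) SM h_min t k i *
    (u (t - k).+1 w 0 i + G (t - k)%N w 0 i / h (t - k).+1).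
  have m1 i t : P.-integrable setT (EFin \o (fun w => \sum_(k < t.+1) T t k i w)) /\
      \int[P]_w (\sum_(k < t.+1) T t k i w) = 0.
    have [i1 ->] := Rintegral_sum (index_enum 'I_t.+1)
      (fun k : 'I_t.+1 => proj1 (mean t k i)).
    by split => //; apply: big1 => k _; exact: proj2 (mean t k i).
  have m2 i : P.-integrable setT (EFin \o (fun w =>
        \sum_(t < K) \sum_(k < t.+1) T t k i w)) /\
      \int[P]_w (\sum_(t < K) \sum_(k < t.+1) T t k i w) = 0.
    have [i1 ->] := Rintegral_sum (index_enum 'I_K) (fun t : 'I_K => proj1 (m1 i t)).
    by split => //; apply: big1 => t _; exact: proj2 (m1 i t).
  have [i1 R1] := Rintegral_sum (index_enum 'I_n) (fun i : 'I_n => proj1 (m2 i)).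
  split; first exact: i1.
  by rewrite [LHS]R1; apply: big1 => i _; exact: proj2 (m2 i).
pose Lam := ln (1 + SM ^+ 2 / (h_min ^+ 2 * (1 - beta2) * eps)) - K%:R * ln beta2.
have K_pos : 0 < K%:R :> R by rewrite ltr0n.
have logsE : logs = Lam / K%:R.
  by rewrite /logs /Lam SM2; field; rewrite gt_eqF.
have Lam_ge0 : 0 <= Lam.
  rewrite /Lam addr_ge0 //.
    rewrite ln_ge0 // lerDl divr_ge0 ?sqr_ge0 //.
    by rewrite !mulr_ge0 ?sqr_ge0 ?(ltW heps) ?(ltW hh_min) // subr_ge0 ltW.
  by rewrite -mulrN mulr_ge0 // oppr_ge0 ln_le0 // ltW.
pose a := Num.sqrt (1 - beta1); pose b := Num.sqrt (1 - beta2).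
pose e := Num.sqrt (1 - beta1 / beta2).
have qlt1 : beta1 / beta2 < 1 by rewrite ltr_pdivrMr // mul1r.
have a2 : 1 - beta1 = a ^+ 2 by rewrite sqr_sqrtr // subr_ge0 ltW.
have b2 : 1 - beta2 = b ^+ 2 by rewrite sqr_sqrtr // subr_ge0 ltW.
have e2 : 1 - beta1 / beta2 = e ^+ 2 by rewrite sqr_sqrtr // subr_ge0 ltW.
have a0 : 0 < a by rewrite sqrtr_gt0 subr_gt0.
have b0 : 0 < b by rewrite sqrtr_gt0 subr_gt0.
have e0 : 0 < e by rewrite sqrtr_gt0 subr_gt0.
have pow32 (y z : R) : 0 < z -> y = z ^+ 2 -> y `^ (3 / 2) = z ^+ 2 * z.
  move=> z0 ->; rewrite (_ : 3 / 2 = 1 + 2^-1); last by field.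
  rewrite powRD; last by rewrite expf_eq0 (gt_eqF z0) implybT.
  by rewrite powRr1 ?sqr_ge0 // powR12_sqrt ?sqr_ge0 // sqrtr_sqr ger0_norm // ltW.
have rate := rate_constants beta1 L_Pf L_f L_J rho_max kappa_c
  (merit f c x1 tau - tau * finf) a0 b0 e0 SM_gt0 tau_gt0 a_gt0
  hsigma_min hh_min h_max_gt0 K_pos (ler0n R n) Lam_ge0.
rewrite -(pow32 _ _ b0 b2) -(pow32 _ _ e0 e2) -logsE -a2 -b2 -e2 in rate.
have path w := pathwise_bound (hrun w) b1_ge0 b12 b2_lt1 halpha heps Xconvex
  (xX^~ w) hL_f hsigma_min hkappa_f f_diff f_lb c_ub gradf_ub gradf_lip J_sigma
  SM_gt0 hh_min rho_min_gt0 rho_max1 (fun k => rho_bnd k.+1 (ltn0Sn k)) h_bnd'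
  (fun k i => u_bnd' k w i) hL_J hL_Pf c_descent Pgradf_lip K.
set D := _ + alpha * tau * _ + _ in rate.
have path' w : \sum_(t < K) obj t w <= D / (alpha * tau) + nz w.
  rewrite -(ler_pM2l at_gt0) mulrDr.
  rewrite [alpha * tau * (D / _)]mulrC (divfK (lt0r_neq0 at_gt0)).
  apply: le_trans (path w) _; rewrite /D (pow32 _ _ e0 e2) -e2.
  have regroup (A t z E1 E2 E3 : R) :
      A + t * (z + E1 + E2) + E3 = A + t * (E1 + E2) + E3 + t * z by ring.
  by rewrite [leLHS]regroup.
have RL_le : \int[P]_w (\sum_(t < K) obj t w) <= D / (alpha * tau).
  have iD : P.-integrable setT (EFin \o (fun=> D / (alpha * tau))).
    exact: finite_measure_integrable_cst.
  apply: le_trans (le_Rintegral measurableT iL (integrableD measurableT iD iZ)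
    (fun w _ => path' w)) _.
  rewrite RintegralD // RZ addr0 Rintegral_cst //.
  by rewrite (_ : fine _ = 1) ?mulr1 //; exact: (congr1 fine (probability_setT P)).
have -> : (\sum_(1 <= k < K.+1) (coef%:E
      * 'E_P[(fun w => norm2 (Pmx c (x k w) *v grad f (x k w)) ^+ 2)%R]
      + rho_min%:E * 'E_P[(fun w => norm1 (c (x k w)))%R])
    = (\int[P]_w (\sum_(t < K) obj t w))%:E)%E.
  rewrite big_add1 big_mkord /= RL -sumEFin; apply: eq_bigr => t _.
  by rewrite Robj (EE _ (iN2 t)) (EE _ (iC1 t)) EFinD !EFinM.
rewrite -EFinM lee_fin; apply: (le_trans _ rate).
rewrite invfM mulrA mulrC ler_wpM2r // invr_ge0 ltW //.
Qed.
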